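(* Let $n\geq 2$, $\delta\in(0,1)$, $\tau\in(0,\infty)$, $s\geq 1$, and let $\Omega\subset\mathbb{R}^n$ be an $s$-John domain. If $p<n/\delta$, $s<\frac{n}{n-p\delta}$ and $$1\leq p\leq q<\frac{np}{s(n-p\delta)+(s-1)(p-1)},$$ then $\Omega$ supports the fractional $(q,p)$-Sobolev-Poincaré inequality: there is a constant $C$ such that for every $u\in C(\Omega)$ $$\int_\Omega|u(x)-u_\Omega|^q\,dx\leq C\Big(\int_\Omega\int_{\Omega\cap B(x,\tau d(x,\partial\Omega))}\frac{|u(x)-u(y)|^p}{|x-y|^{n+p\delta}}\,dy\,dx\Big)^{q/p}.$$
   Context: For $s\geq 1$, a bounded domain $\Omega\subset\mathbb{R}^n$ is an $s$-John domain if there are a constant $C$ and a point $x_0\in\Omega$ such that for each $x\in\Omega$ one can find a rectifiable curve $\gamma:[0,1]\to\Omega$ with $\gamma(0)=x$, $\gamma(1)=x_0$ and $$C\,d(\gamma(t),\partial\Omega)\geq l(\gamma([0,t]))^s\quad\text{for each } 0<t\leq 1,$$ where $l$ denotes length and $d(\cdot,\partial\Omega)$ is the Euclidean distance to the boundary. $C(\Omega)$ is the set of continuous real-valued functions on $\Omega$; $u_\Omega=\frac{1}{|\Omega|}\int_\Omega u(x)\,dx$; $B(x,r)$ is the Euclidean ball with centre $x$ and radius $r$. *)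

(* Defs.v *)
From HB Require Import structures.
From mathcomp Require Import all_boot all_order all_algebra.
From mathcomp Require Import all_classical all_reals all_analysis.

Set Implicit Arguments.
Unset Strict Implicit.
Unset Printing Implicit Defensive.

Import Order.TTheory GRing.Theory Num.Theory.
Import numFieldNormedType.Exports.

Local Open Scope classical_set_scope.
Local Open Scope ring_scope.

(* R^n is 'rV[R]_n.  Its library topology (and bounded sets) come from the
   max norm, hence are the Euclidean ones; the library norm `|x| is the max
   norm and is not used for distances, see enorm below. *)

(* The sigma-algebra on R^n generated by the n coordinates, i.e. the product
   of the Borel sigma-algebras of R, which is the Borel sigma-algebra of R^n. *)
Definition rV_display : measure_display.
Proof. exact: default_measure_display. Qed.

Section measurable_rV.
Context {R : realType} (n : nat).

Let coors (i : 'I_n) (x : 'rV[R]_n) : measurableTypeR R := x ord0 i.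

Let rV_set0 : g_sigma_preimage coors set0.
Proof. exact: sigma_algebra0. Qed.

Let rV_setC A : g_sigma_preimage coors A -> g_sigma_preimage coors (~` A).
Proof. exact: sigma_algebraC. Qed.

Let rV_bigcup (F : (set 'rV[R]_n)^nat) :
  (forall i, g_sigma_preimage coors (F i)) ->
  g_sigma_preimage coors (\bigcup_i (F i)).
Proof. exact: sigma_algebra_bigcup. Qed.

HB.instance Definition _ := @isMeasurable.Build rV_display
  'rV[R]_n (g_sigma_preimage coors) rV_set0 rV_setC rV_bigcup.

Lemma measurable_coord (i : 'I_n) :
  measurable_fun [set: 'rV[R]_n] (fun x => x ord0 i : measurableTypeR R).
Proof.
move=> _ Y mY; rewrite setTI; apply: sub_sigma_algebra => /=.
rewrite -bigcup_seq/=; exists i => /=; first by rewrite mem_index_enum.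
by exists Y => //; rewrite setTI.
Qed.

Lemma measurable_fun_coordP d (T : measurableType d) (f : T -> 'rV[R]_n) :
  measurable_fun [set: T] f <->
  forall i, measurable_fun [set: T] (fun t => f t ord0 i : measurableTypeR R).
Proof.
split=> [mf i|mf].
  exact: (measurableT_comp (measurable_coord i) mf).
have : g_sigma_preimage (fun i t => coors i (f t)) `<=` measurable.
  apply: smallest_sub; first exact: sigma_algebra_measurable.
  move=> A; rewrite -bigcup_seq => -[i _ [B mB <-]].
  exact: mf.
rewrite (g_sigma_preimage_comp coors f) => sub _ A mA.
by apply: sub; exists A.
Qed.

End measurable_rV.

(* Lebesgue measure on R^n, as the n-fold product of Lebesgue measure on R:
   R^(n+1) is identified with R * R^n. *)
Section lebesgue_rV.
Context {R : realType}.

Definition rV_cons n (x : measurableTypeR R * 'rV[R]_n) : 'rV[R]_n.+1 :=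
  row_mx (const_mx x.1 : 'rV[R]_1) x.2.

Definition rV_uncons n (x : 'rV[R]_n.+1) : measurableTypeR R * 'rV[R]_n :=
  (x ord0 ord0, \row_i x ord0 (lift ord0 i)).

Lemma rV_cons0 n x : @rV_cons n x ord0 ord0 = x.1.
Proof.
transitivity (@rV_cons n x ord0 (lshift n (ord0 : 'I_1))).
  by congr (rV_cons x _ _); exact/val_inj.
by apply: etrans (row_mxEl _ _ _ _) _; rewrite mxE.
Qed.

Lemma rV_consS n x i : @rV_cons n x ord0 (lift ord0 i) = x.2 ord0 i.
Proof.
transitivity (@rV_cons n x ord0 (rshift 1 i)).
  by congr (rV_cons x _ _); exact/val_inj.
exact: row_mxEr.
Qed.

Lemma rV_consK n : cancel (@rV_cons n) (@rV_uncons n).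
Proof.
move=> [a v]; rewrite /rV_uncons rV_cons0; congr pair.
by apply/rowP => i; rewrite mxE rV_consS.
Qed.

Lemma rV_unconsK n : cancel (@rV_uncons n) (@rV_cons n).
Proof.
move=> x; apply/rowP => i; have [j ->|->] := unliftP ord0 i.
  by rewrite rV_consS mxE.
by rewrite rV_cons0.
Qed.

Lemma measurable_rV_cons n : measurable_fun setT (@rV_cons n).
Proof.
apply/measurable_fun_coordP => i; have [j ->|->] := unliftP ord0 i.
  under eq_fun do rewrite rV_consS.
  exact: (measurableT_comp (measurable_coord j) measurable_snd).
under eq_fun do rewrite rV_cons0.
exact: measurable_fst.
Qed.

Lemma measurable_rV_uncons n : measurable_fun setT (@rV_uncons n).
Proof.
apply: measurable_fun_pair; first exact: measurable_coord.
apply/measurable_fun_coordP => i; under eq_fun do rewrite mxE.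
exact: measurable_coord.
Qed.

Section cons_measure.
Variables (n : nat) (mu : {sigma_finite_measure set 'rV[R]_n -> \bar R}).

Definition rV_cons_measure : set 'rV[R]_n.+1 -> \bar R :=
  pushforward (lebesgue_measure \x mu)%E (@rV_cons n).

Let rV_cons_measure0 : rV_cons_measure set0 = 0%E.
Proof. by rewrite /rV_cons_measure /pushforward preimage_set0 measure0. Qed.

Let mpre A : measurable A -> measurable (@rV_cons n @^-1` A).
Proof.
by move=> mA; rewrite -[X in measurable X]setTI; exact: measurable_rV_cons.
Qed.

Let rV_cons_measure_ge0 A : (0 <= rV_cons_measure A)%E.
Proof. by rewrite /rV_cons_measure /pushforward measure_ge0. Qed.

Let rV_cons_measure_sigma_additive : semi_sigma_additive rV_cons_measure.
Proof.
move=> F mF tF mUF; rewrite /rV_cons_measure /pushforward preimage_bigcup.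
apply: measure_semi_sigma_additive.
- by move=> k; exact: mpre.
- apply/trivIsetP => /= i j _ _ ij; rewrite -preimage_setI.
  by move/trivIsetP : tF => /(_ _ _ _ _ ij) ->//; rewrite preimage_set0.
- by rewrite -preimage_bigcup; exact: mpre.
Qed.

HB.instance Definition _ := isMeasure.Build _ _ _ rV_cons_measure
  rV_cons_measure0 rV_cons_measure_ge0 rV_cons_measure_sigma_additive.

Let rV_cons_measure_sigma_finite : sigma_finite setT rV_cons_measure.
Proof.
have /sigma_finiteP[F [TF ndF Foo]] := sigma_finiteT (@lebesgue_measure R).
have /sigma_finiteP[G [TG ndG Goo]] := sigma_finiteT mu.
exists (fun k => @rV_uncons n @^-1` (F k `*` G k)).
  rewrite -preimage_bigcup predeqE => x; split=> // _.
  have [i _ Fi] : (\bigcup_i F i) (rV_uncons x).1 by rewrite -TF.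
  have [j _ Gj] : (\bigcup_j G j) (rV_uncons x).2 by rewrite -TG.
  exists (maxn i j) => //; split.
  - by move: (rV_uncons x).1 Fi; exact/subsetPset/ndF/leq_maxl.
  - by move: (rV_uncons x).2 Gj; exact/subsetPset/ndG/leq_maxr.
move=> k; have [? ?] := Foo k; have [? ?] := Goo k; split.
  rewrite -[X in measurable X]setTI; apply: measurable_rV_uncons => //.
  exact: measurableX.
rewrite /rV_cons_measure /pushforward -comp_preimage.
rewrite (_ : _ \o _ = id) ?preimage_id; last first.
  by apply/funext => x /=; rewrite rV_consK.
by rewrite product_measure1E// lte_mul_pinfty// ge0_fin_numE.
Qed.

HB.instance Definition _ := Measure_isSigmaFinite.Build _ _ _ rV_cons_measure
  rV_cons_measure_sigma_finite.

End cons_measure.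

Fixpoint lebesgue_rV n : {sigma_finite_measure set 'rV[R]_n -> \bar R} :=
  match n with
  | 0 => dirac (0 : 'rV[R]_0)
  | n'.+1 => rV_cons_measure (lebesgue_rV n')
  end.

Lemma lebesgue_rV_box n (A : 'I_n -> set (measurableTypeR R)) :
  (forall i, measurable (A i)) ->
  lebesgue_rV n [set x : 'rV[R]_n | forall i, A i (x ord0 i)] =
  (\prod_(i < n) lebesgue_measure (A i))%E.
Proof.
elim: n A => [|n IH] A mA.
  rewrite big_ord0 /= diracE mem_set//=. by case.
rewrite big_ord_recl /= /rV_cons_measure /pushforward -IH; last by [].
rewrite -product_measure1E //.
  congr (product_measure1 _ _ _); apply/seteqP; split => -[a v] /=.
    move=> H; split => /=; first by have := H ord0; rewrite rV_cons0.
    by move=> i; have := H (lift ord0 i); rewrite rV_consS.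
  move=> [/= Aa Av] i; have [j ->|->] := unliftP ord0 i; by rewrite ?rV_consS ?rV_cons0.
have -> : [set x : 'rV[R]_n | forall i, A (lift ord0 i) (x ord0 i)] =
  \bigcap_(i in [set: 'I_n]) ((fun x : 'rV[R]_n => x ord0 i) @^-1` A (lift ord0 i)).
  by apply/seteqP; split => x /= H i; [move=> _|]; exact: H.
apply: fin_bigcap_measurable => // i _.
by rewrite -[X in measurable X]setTI; apply: measurable_coord.
Qed.

End lebesgue_rV.

Section euclidean.
Context {R : realType} {n : nat}.
Implicit Types (x y : 'rV[R]_n) (A : set 'rV[R]_n).

Definition enorm x : R := Num.sqrt (\sum_i x ord0 i ^+ 2).

Definition eball x (r : R) : set 'rV[R]_n := [set y | enorm (x - y) < r].

Definition boundary A : set 'rV[R]_n := closure A `\` interior A.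

Definition dist_set x A : R := inf [set enorm (x - y) | y in A].

(* Length of the curve g restricted to [a, b]: supremum of the lengths of the
   inscribed polygonal lines (the analogue of total_variation for curves). *)
Definition curve_length (a b : R) (g : R -> 'rV[R]_n) : \bar R :=
  ereal_sup [set (\sum_(0 <= k < size l)
    enorm (g (nth b (a :: l) k.+1) - g (nth b (a :: l) k)))%:E
    | l in itv_partition a b].

End euclidean.

Section john.
Context {R : realType} {n : nat}.

Definition bounded_domain (Omega : set 'rV[R]_n) :=
  [/\ open Omega, connected Omega & bounded_set Omega].

Definition john_curve (s C : R) (Omega : set 'rV[R]_n) (x0 x : 'rV[R]_n)
    (g : R -> 'rV[R]_n) :=
  [/\ {within `[0, 1], continuous g} /\ g @` `[0, 1] `<=` Omega,
      (curve_length 0 1 g < +oo)%E,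
      g 0 = x, g 1 = x0 &
      forall t : R, 0 < t <= 1 ->
        (curve_length 0 t g `^ s <= (C * dist_set (g t) (boundary Omega))%:E)%E].

Definition john_domain (s : R) (Omega : set 'rV[R]_n) :=
  bounded_domain Omega /\
  exists (C : R) (x0 : 'rV[R]_n), Omega x0 /\
    forall x, Omega x -> exists g, john_curve s C Omega x0 x g.

End john.

Section sobolev_poincare.
Context {R : realType} {n : nat}.
Local Notation mu := (@lebesgue_rV R n).

Definition average (Omega : set 'rV[R]_n) (u : 'rV[R]_n -> R) : R :=
  (fine (mu Omega))^-1 * \int[mu]_(x in Omega) u x.

(* The value 0 `^ (n + p delta) = 0 gives the integrand the value 0 on the
   (null) diagonal x = y. *)
Definition fractional_energy (delta tau p : R) (Omega : set 'rV[R]_n)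
    (u : 'rV[R]_n -> R) : \bar R :=
  (\int[mu]_(x in Omega)
    \int[mu]_(y in Omega `&` eball x (tau * dist_set x (boundary Omega)))
      (`|u x - u y| `^ p / enorm (x - y) `^ (n%:R + p * delta))%:E)%E.

(* u need not be integrable: then (Omega having finite measure and q >= 1) the
   left-hand side is +oo whatever real number average Omega u is.  With C > 0,
   the inequality holds trivially when the energy is +oo. *)
Definition fractional_sobolev_poincare (delta tau q p : R)
    (Omega : set 'rV[R]_n) :=
  exists2 C : R, 0 < C &
    forall u : 'rV[R]_n -> R, {within Omega, continuous u} ->
      (\int[mu]_(x in Omega) (`|u x - average Omega u| `^ q)%:E
        <= C%:E * fractional_energy delta tau p Omega u `^ (q / p))%E.

End sobolev_poincare.

(* Main.v *)
Require Import Defs.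
From mathcomp Require Import all_boot all_order all_algebra.
From mathcomp Require Import all_classical all_reals all_analysis.
From mathcomp Require Import measurable_realfun.
From mathcomp Require Import ring lra.
Import Order.TTheory GRing.Theory Num.Theory.
Import numFieldNormedType.Exports.
Local Open Scope classical_set_scope.
Local Open Scope ring_scope.
Set Implicit Arguments.
Unset Strict Implicit.
Unset Printing Implicit Defensive.

(** The point x is joined to the John center x0 by a curve of length at most L.
    Its part at arc length about h_j = L / 2^j from x stays at distance at least
    a multiple of h_j^s from the boundary, so it is covered by cells of a cubic
    grid of side r_j = a 2^(-js), a small.  Discarding loops leaves a chain of at
    most C 2^(j(s-1)) distinct, hence disjoint, neighbouring cells.  On such a
    chain the oscillation of the averages of u is controlled, by Young's
    inequality, by (2^(j kappa) G_j(x))^(1/p), where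
    kappa = s(n - p delta) + (s-1)(p-1) and G_j(x) is the energy carried by the
    cube of center x and half-side 4 h_j.  Summing over j bounds |u(x) - c|,
    with c the average over one fixed cell at x0.  By Tonelli the integral of
    G_j^(q/p) is at most C E^(q/p) 2^(-jn), E being the total energy, and since
    q kappa < n p the sum over j still converges after a small geometric weight
    2^(eps j) is inserted to raise it to the power q. *)

(** * Euclidean norm and distance to the boundary *)

(** The curve joining x to x0 need not depend measurably on x. Hence every estimate along it ends in
    G_j(x), which depends on x alone and can be integrated. All cells of one level have equal side,
    so distinct ones are disjoint and their energies add up with no overlap constant. The exponent
    kappa comes from a single level. Between two cells of side r at distance comparable to r,
    Young's inequality bounds the oscillation by lam + C lam^(1-p) r^(p delta - n) times the energy
    of the first cell. Over N cells this gives N lam + C lam^(1-p) r^(p delta - n) G_j, and the best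
    lam yields a multiple of N^(1-1/p) (r^(p delta - n) G_j)^(1/p). For N of order 2^(j(s-1)) and r
    = r_j, the cell count contributes (s-1)(p-1) to kappa and the cell size contributes s(n - p
    delta). The free parameter lam thus does the work of Hölder's inequality both on each cell and
    along the chain. *)

Section enorm_theory.
Context {R : realType} {n : nat}.
Implicit Types (x y z : 'rV[R]_n) (A : set 'rV[R]_n).

Lemma enorm_ge0 x : 0 <= enorm x.
Proof. exact: sqrtr_ge0. Qed.

Lemma sqr_enorm x : enorm x ^+ 2 = \sum_i x ord0 i ^+ 2.
Proof. by rewrite sqr_sqrtr// sumr_ge0// => i _; rewrite sqr_ge0. Qed.

Lemma enorm0 : enorm (0 : 'rV[R]_n) = 0.
Proof. by rewrite /enorm big1 ?sqrtr0// => i _; rewrite mxE expr0n. Qed.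

Lemma enormN x : enorm (- x) = enorm x.
Proof. by congr Num.sqrt; apply: eq_bigr => i _; rewrite mxE sqrrN. Qed.

Lemma enormB x y : enorm (x - y) = enorm (y - x).
Proof. by rewrite -opprB enormN. Qed.

Lemma enormZ (a : R) x : 0 <= a -> enorm (a *: x) = a * enorm x.
Proof.
move=> a0; rewrite /enorm -[X in X * _](ger0_norm a0) -sqrtr_sqr -sqrtrM ?sqr_ge0//.
by rewrite mulr_sumr; congr Num.sqrt; apply: eq_bigr => i _; rewrite mxE exprMn.
Qed.

Lemma coord_le_enorm x i : `|x ord0 i| <= enorm x.
Proof.
rewrite -sqrtr_sqr ler_wsqrtr// (bigD1 i)//= lerDl sumr_ge0// => j _.
exact: sqr_ge0.
Qed.

Lemma enorm_eq0 x : enorm x = 0 -> x = 0.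
Proof.
move=> x0; apply/rowP => i; rewrite mxE; apply/eqP; rewrite -normr_le0 -x0.
exact: coord_le_enorm.
Qed.

Lemma enorm_gt0 x : x != 0 -> 0 < enorm x.
Proof.
by move=> x0; rewrite lt0r enorm_ge0 andbT; apply: contra_neq x0; exact: enorm_eq0.
Qed.

(** Sum the inequalities (x_i |y| - y_i |x|)^2 >= 0 over i: this is the claim multiplied by 2 |x|
    |y|, whence the separate treatment of zero vectors. *)
Lemma enorm_cauchy x y : \sum_i x ord0 i * y ord0 i <= enorm x * enorm y.
Proof.
have [->|x0] := eqVneq x 0.
  by rewrite big1 ?enorm0 ?mul0r// => i _; rewrite mxE mul0r.
have [->|y0] := eqVneq y 0.
  by rewrite big1 ?enorm0 ?mulr0// => i _; rewrite mxE mulr0.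
have xy0 : 0 < 2 * (enorm x * enorm y) by rewrite !mulr_gt0// enorm_gt0.
rewrite -(ler_pM2l xy0).
have -> : 2 * (enorm x * enorm y) * (enorm x * enorm y) =
    \sum_i (enorm y ^+ 2 * x ord0 i ^+ 2 + enorm x ^+ 2 * y ord0 i ^+ 2).
  by rewrite big_split/= -!mulr_sumr -!sqr_enorm; ring.
rewrite mulr_sumr; apply: ler_sum => i _; rewrite -subr_ge0.
by apply: le_trans (sqr_ge0 (x ord0 i * enorm y - y ord0 i * enorm x)) _; lra.
Qed.

Lemma enormD x y : enorm (x + y) <= enorm x + enorm y.
Proof.
rewrite -ler_sqr ?nnegrE ?addr_ge0 ?enorm_ge0// sqrrD !sqr_enorm.
have -> : \sum_i (x + y) ord0 i ^+ 2 = \sum_i x ord0 i ^+ 2 +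
    (\sum_i x ord0 i * y ord0 i) *+ 2 + \sum_i y ord0 i ^+ 2.
  rewrite -sumrMnl -!big_split/=; apply: eq_bigr => i _.
  by rewrite mxE sqrrD.
by rewrite lerD2r lerD2l lerMn2r enorm_cauchy orbT.
Qed.

Lemma enorm_dist_triangle y x z : enorm (x - z) <= enorm (x - y) + enorm (y - z).
Proof. by rewrite -[x - z](subrKA y) enormD. Qed.

Lemma enorm_le (b : R) x : (forall i, `|x ord0 i| <= b) -> enorm x <= n%:R * b.
Proof.
move=> xb; apply: (@le_trans _ _ (\sum_i `|x ord0 i|)); last first.
  apply: le_trans (ler_sum _ (fun i _ => xb i)) _.
  by rewrite sumr_const card_ord mulr_natl.
rewrite -ler_sqr ?nnegrE ?enorm_ge0 ?sumr_ge0// sqr_enorm expr2 mulr_suml.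
apply: ler_sum => i _; rewrite -real_normK ?num_real// expr2 ler_wpM2l// (bigD1 i)//= lerDl.
exact: sumr_ge0.
Qed.

(** Balls and neighbourhoods of the library are those of the max norm; this comparison and
    [enorm_le_norm] pass between them and Euclidean distances. *)
Lemma norm_le_enorm x : `|x| <= enorm x.
Proof.
rewrite -[`|x|]/(mx_norm x) mx_normrE; apply/bigmax_leP; split => [|[i j] _ /=].
  exact: enorm_ge0.
by rewrite ord1; exact: coord_le_enorm.
Qed.

Lemma coord_le_norm x i : `|x ord0 i| <= `|x|.
Proof.
rewrite -[`|x|]/(mx_norm x) mx_normrE.
exact: (le_bigmax _ (fun k : 'I_1 * 'I_n => `|x k.1 k.2|) (ord0, i)).
Qed.

Lemma norm_lt_coord x (e : R) : 0 < e -> (forall i, `|x ord0 i| < e) -> `|x| < e.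
Proof.
move=> e0 xe; rewrite -[`|x|]/(mx_norm x) mx_normrE; apply/bigmax_ltP; split => // -[i j] _ /=.
by rewrite ord1.
Qed.

Lemma enorm_le_norm x : enorm x <= n%:R * `|x|.
Proof. by apply: enorm_le => i; exact: coord_le_norm. Qed.

Lemma dist_set_lb A x : has_lbound [set enorm (x - y) | y in A].
Proof. by exists 0 => _ [y _ <-]; exact: enorm_ge0. Qed.

Lemma dist_set_le A x y : A y -> dist_set x A <= enorm (x - y).
Proof. by move=> Ay; apply: ge_inf; [exact: dist_set_lb|exists y]. Qed.

Lemma dist_set_ge0 A x : 0 <= dist_set x A.
Proof.
(* The infimum of the empty set is 0 by convention. *)
have [->|/set0P[y Ay]] := eqVneq A set0; first by rewrite /dist_set image_set0 inf0.
apply: lb_le_inf; first by exists (enorm (x - y)), y.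
by move=> _ [z _ <-]; exact: enorm_ge0.
Qed.

Lemma dist_set_lip A x y : dist_set x A <= dist_set y A + enorm (x - y).
Proof.
have [->|/set0P[z Az]] := eqVneq A set0.
  by rewrite /dist_set !image_set0 inf0 add0r enorm_ge0.
rewrite -lerBlDr; apply: lb_le_inf; first by exists (enorm (y - z)), z.
move=> _ [w Aw <-]; rewrite lerBlDr addrC.
by apply: le_trans (enorm_dist_triangle y _ _); exact: dist_set_le.
Qed.

(** On the segment from x to y, the parameters of points of A form a relatively open set. It is also
    relatively closed: a point of the closure of A outside A would be a boundary point closer to x
    than the boundary is. Connectedness of [0, 1] concludes. *)
Lemma ball_boundary_subset A x y : open A -> A x ->
  enorm (x - y) < dist_set x (boundary A) -> A y.
Proof.
move=> oA Ax xy.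
pose f (t : R) := x + t *: (y - x).
have cf : continuous f.
  by move=> t; apply: cvgD; [exact: cvg_cst|apply: cvgZr_tmp; exact: cvg_id].
have fA t : t \in `[0, 1] -> closure A (f t) -> A (f t).
  rewrite in_itv/= => /andP[t0 t1] cAf; apply: contrapT => nAf.
  have /(dist_set_le x) : boundary A (f t) by split=> // /interior_subset.
  rewrite leNgt => /negP; apply; apply: le_lt_trans xy.
  rewrite /f opprD addNKr -scalerN opprB enormZ//.
  by rewrite ler_piMl ?enorm_ge0.
suff <- : f 1 = y.
  have -> : (A (f 1)) = (f @^-1` A) 1 by [].
  have: (`[0, 1] `&` f @^-1` A) 1; last by case.
  rewrite (segment_connected (a := 0) (b := 1) (B := `[0, 1] `&` f @^-1` A)) //=.
  - by rewrite in_itv/= ler01 lexx.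
  - exists 0; split; first by rewrite /= in_itv/= lexx ler01.
    by rewrite /= /f scale0r addr0.
  - by exists (f @^-1` A) => //; apply: open_comp.
  - exists (f @^-1` closure A); first by apply: closed_comp => //; exact: closed_closure.
    apply/seteqP; split=> t [? ?]; split=> //; first exact: subset_closure.
    exact: fA.
by rewrite /f scale1r subrKC.
Qed.

End enorm_theory.

(** * Grid cells and measurability *)

Section cells.
Context {R : realType} {n : nat}.
Implicit Types (x y z : 'rV[R]_n) (A : set 'rV[R]_n) (k : 'rV[int]_n) (r : R).
Local Notation mu := (@lebesgue_rV R n).

Lemma measurable_box (A : 'I_n -> set (measurableTypeR R)) :
  (forall i, measurable (A i)) ->
  measurable [set x : 'rV[R]_n | forall i, A i (x ord0 i)].
Proof.
move=> mA.
have -> : [set x : 'rV[R]_n | forall i, A i (x ord0 i)] =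
    \bigcap_(i in [set: 'I_n]) ((fun x : 'rV[R]_n => x ord0 i) @^-1` A i).
  by apply/seteqP; split => x /= H i; [move=> _|]; exact: H.
apply: fin_bigcap_measurable => // i _.
by rewrite -[X in measurable X]setTI; apply: measurable_coord.
Qed.

Lemma lebesgue_cube (A : 'I_n -> set (measurableTypeR R)) (v : R) :
  (forall i, measurable (A i)) -> (forall i, lebesgue_measure (A i) = v%:E) ->
  mu [set x : 'rV[R]_n | forall i, A i (x ord0 i)] = (v ^+ n)%:E.
Proof.
move=> mA Av; rewrite lebesgue_rV_box//.
rewrite (eq_bigr (fun=> v%:E)) => [|i _]; last exact: Av.
by rewrite prodEFin prodr_const card_ord.
Qed.

Definition cell_index r x : 'rV[int]_n := \row_i Num.floor (x ord0 i / r).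

(** Being fibres of one function, cells of equal side and different index are disjoint, and every
    point lies in exactly one. *)
Definition cell r k : set 'rV[R]_n := cell_index r @^-1` [set k].

Lemma cell_box r k : 0 < r ->
  cell r k = [set x | forall i,
    ([set` `[(k ord0 i)%:~R * r, (k ord0 i + 1)%:~R * r[] : set R) (x ord0 i)].
Proof.
move=> r0; apply/seteqP; split=> x /= => [<- i|H].
  by rewrite in_itv/= !mxE -ler_pdivlMr// -ltr_pdivrMr// floor_itv.
apply/rowP => i; rewrite mxE; apply: floor_def.
by have := H i; rewrite in_itv/= ler_pdivlMr// ltr_pdivrMr.
Qed.

Lemma measurable_cell r k : 0 < r -> measurable (cell r k).
Proof. move=> r0; rewrite cell_box//; exact: (@measurable_box (fun i : 'I_n =>
  [set` `[(k ord0 i)%:~R * r, (k ord0 i + 1)%:~R * r[] : set R)). Qed.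

Lemma lebesgue_cell r k : 0 < r -> mu (cell r k) = (r ^+ n)%:E.
Proof.
move=> r0; rewrite cell_box//; apply: (@lebesgue_cube (fun i : 'I_n =>
  [set` `[(k ord0 i)%:~R * r, (k ord0 i + 1)%:~R * r[] : set R)) => // i.
rewrite lebesgue_measure_itv/= lte_fin ltr_pM2r// ltr_int ltrDl ltr01.
by rewrite -EFinB -mulrBl -intrB addrAC subrr add0r mul1r.
Qed.

Lemma cell_coord_lt r x y i : 0 < r -> cell_index r x = cell_index r y ->
  `|(x - y) ord0 i| < r.
Proof.
move=> r0 /rowP/(_ i); rewrite !mxE => xy.
have := floor_itv (x ord0 i / r); have := floor_itv (y ord0 i / r).
rewrite xy intrD !ler_pdivlMr// !ltr_pdivrMr// mulrDl mul1r.
by move=> /andP[? ?] /andP[? ?]; rewrite ltr_norml; apply/andP; split; lra.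
Qed.

Lemma cell_enorm_le r x y : 0 < r -> cell_index r x = cell_index r y ->
  enorm (x - y) <= n%:R * r.
Proof. by move=> r0 xy; apply: enorm_le => i; rewrite ltW// cell_coord_lt. Qed.

(** The sigma-algebra is generated by the coordinates, so an open set is written as a countable
    union of boxes: all cells of side 1/(m+1) that it contains, enumerated by [unpickle]. Two points
    of a cell differ by less than its side in every coordinate, hence a fine enough cell around a
    point of A stays in A. *)
Lemma open_measurable_rV A : open A -> measurable A.
Proof.
move=> oA.
pose F (j : nat) : set 'rV[R]_n :=
  if (unpickle j : option (nat * 'rV[int]_n)) is Some (m, k) then
    if `[< cell m.+1%:R^-1 k `<=` A >] then cell m.+1%:R^-1 k else set0
  else set0.
suff -> : A = \bigcup_j F j.
  apply: bigcupT_measurable => j; rewrite /F; case: unpickle => [[m k]|//].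
  by case: ifPn => // _; apply: measurable_cell.
apply/seteqP; split=> [x Ax|x [j _]]; last first.
  rewrite /F; case: unpickle => [[m k]|//].
  by case: ifPn => // /asboolP; exact.
have /nbhs_ballP[e /= e0 xeA] : nbhs x A by exact: open_nbhs_nbhs.
pose m := Num.truncn (e^-1).
have me : m.+1%:R^-1 <= e.
  by rewrite -[leRHS]invrK lef_pV2 ?posrE ?invr_gt0// ltW// truncnS_gt.
exists (pickle (m, cell_index m.+1%:R^-1 x)) => //.
rewrite /F pickleK ifT//; apply/asboolP => y yx.
apply: xeA; rewrite mx_norm_ball/=; apply: norm_lt_coord => // i.
by apply: lt_le_trans me; apply: cell_coord_lt => //; rewrite yx.
Qed.

Lemma measurable_fun_within_continuous A (u : 'rV[R]_n -> R) : open A ->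
  {within A, continuous u} -> measurable_fun A (u : _ -> measurableTypeR R).
Proof.
move=> oA /continuousP cu.
apply: (measurability _ (RGenOpens.measurableE R)) => //.
move=> _ [_ [a [b ->] <-]]; apply: open_measurable_rV.
have /open_subspaceP[V oV] := cu _ (@interval_open _ (BRight a) (BLeft b) isT isT).
by move=> E; rewrite setIC -E; exact: openI.
Qed.

End cells.

Lemma integrable_cst_lty d (T : measurableType d) (R : realType)
    (mu : {measure set T -> \bar R}) (A : set T) (c : R) : measurable A ->
  (mu A < +oo)%E -> mu.-integrable A (EFin \o cst c).
Proof.
move=> mA Aoo; apply: measurable_bounded_integrable => //.
by exists `|c|; split => // M cM x _; exact: ltW.
Qed.

(** * Averages over sets and over cells *)

Section averages.
Context {R : realType} {n : nat}.
Implicit Types (x y z : 'rV[R]_n) (A : set 'rV[R]_n) (u : 'rV[R]_n -> R).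
Local Notation mu := (@lebesgue_rV R n).

(** The left side is the absolute value of the integral of u - c; multiplying by the measure of A
    avoids a quotient of extended reals. *)
Lemma average_dist A u (c : R) : measurable A ->
  (0 < mu A < +oo)%E -> mu.-integrable A (EFin \o u) ->
  (`|average A u - c|%:E * mu A <= \int[mu]_(x in A) `|u x - c|%:E)%E.
Proof.
move=> mA /andP[A0 Aoo] iu.
have muA : mu A = (fine (mu A))%:E by rewrite fineK// ge0_fin_numE.
have A0' : 0 < fine (mu A) by rewrite fine_gt0// A0.
have ic := integrable_cst_lty c mA Aoo.
have iuc : mu.-integrable A (EFin \o (u \- cst c)).
  by apply: eq_integrable (integrableB mA iu ic).
have -> : (\int[mu]_(x in A) `|u x - c|%:E =
    (\int[mu]_(x in A) `|u x - c|)%:E)%E.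
  rewrite /Rintegral fineK//.
  by apply: integrable_fin_num => //; exact: (integrable_norm iuc).
rewrite muA -EFinM lee_fin -[X in _ * X <= _](gtr0_norm A0') -normrM.
apply: le_trans (le_normr_Rintegral mA iuc); rewrite le_eqVlt; apply/orP; left.
apply/eqP; congr `| _ |.
rewrite (RintegralB mA iu ic) (Rintegral_cst mu mA) /average mulrBl.
by rewrite mulrAC mulVf ?mul1r// gt_eqF.
Qed.

(** A function continuous on an open set may be unbounded there. The closed cube of center z and
    half-side r is compact, lies in A and contains the cell, so u is bounded on the cell. *)
Lemma integrable_cell A u z (r : R) : open A -> {within A, continuous u} ->
  0 < r -> (forall y, (forall i, `|(z - y) ord0 i| <= r) -> A y) ->
  mu.-integrable (cell r (cell_index r z)) (EFin \o u).
Proof.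
move=> oA cu r0 zA.
pose K := [set y : 'rV[R]_n |
  forall i, ([set` `[z ord0 i - r, z ord0 i + r]] : set R) (y ord0 i)].
have KE y : K y <-> forall i, `|(z - y) ord0 i| <= r.
  split=> H i; have := H i; rewrite /= in_itv/= !mxE distrC ler_distl; exact.
have cK : compact K.
  apply: (@rV_compact R n (fun i : 'I_n =>
    [set` `[z ord0 i - r, z ord0 i + r]] : set R)) => i.
  exact: segment_compact.
have cellK : cell r (cell_index r z) `<=` K.
  by move=> y yz; apply/KE => i; rewrite ltW// cell_coord_lt.
have KA : K `<=` A by move=> y /KE; exact: zA.
apply: measurable_bounded_integrable.
- exact: measurable_cell.
- by have := ltry (r ^+ n); rewrite -(lebesgue_cell (cell_index r z) r0).
- apply: measurable_funS (measurable_fun_within_continuous oA cu).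
    exact: open_measurable_rV.
  exact: subset_trans KA.
have /compact_bounded[M [Mr MK]] : compact (u @` K).
  apply: continuous_compact cK; exact: continuous_subspaceW cu.
by exists M; split => // N /MK {}MK y /cellK Ky; apply: MK; exists y.
Qed.

End averages.

(** * Energy density and oscillation of averages *)

Section energy_density.
Context {R : realType} {n : nat}.
Local Notation rV := 'rV[R]_n.
Local Notation mu := (@lebesgue_rV R n).

Lemma dist_set_continuous (A : set rV) : continuous (fun x : rV => dist_set x A).
Proof.
move=> x B /nbhs_ballP[e /= e0 eB]; apply/nbhs_ballP; exists (e / n.+1%:R); first by rewrite /= divr_gt0.
move=> y; rewrite mx_norm_ball/= => xy.
apply: eB; change (`|dist_set x A - dist_set y A| < e).
apply: (@le_lt_trans _ _ (enorm (x - y))).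
  by rewrite ler_distl lerBlDr dist_set_lip andbT enormB dist_set_lip.
apply: le_lt_trans (enorm_le_norm _) _.
rewrite ltr_pdivlMr// mulrC in xy; apply: le_lt_trans xy.
by rewrite ler_wpM2r// ler_nat.
Qed.

Lemma measurable_dist_set (A : set rV) :
  measurable_fun setT (fun x : rV => dist_set x A : measurableTypeR R).
Proof.
apply: measurable_fun_within_continuous; first exact: openT.
by apply: continuous_subspaceT; exact: dist_set_continuous.
Qed.

Lemma measurable_enormB :
  measurable_fun setT (fun xy : rV * rV => enorm (xy.1 - xy.2) : measurableTypeR R).
Proof.
apply: (measurableT_comp (continuous_measurable_fun (@sqrt_continuous R))).
apply: measurable_sum => i; apply: measurable_funX.
under eq_fun do rewrite !mxE.
apply: measurable_funB.
  exact: (measurableT_comp (measurable_coord i) measurable_fst).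
exact: (measurableT_comp (measurable_coord i) measurable_snd).
Qed.

Variables (delta tau p : R) (Omega : set rV) (u : rV -> R).
Hypotheses (oO : open Omega) (cu : {within Omega, continuous u}).

Definition gagliardo_kernel (x y : rV) : R :=
  `|u x - u y| `^ p / enorm (x - y) `^ (n%:R + p * delta).

(** The inner domain of integration, which varies with x, is encoded as a fixed subset of the
    product; extending the kernel by 0 outside it gives access to joint measurability and
    Tonelli. *)
Definition energy_domain : set (rV * rV) :=
  [set xy | [/\ Omega xy.1, Omega xy.2 &
    enorm (xy.1 - xy.2) < tau * dist_set xy.1 (boundary Omega)]].

Definition energy_kernel : rV * rV -> \bar R :=
  (fun xy => (gagliardo_kernel xy.1 xy.2)%:E) \_ energy_domain.

Definition energy_density (x : rV) : \bar R :=
  (\int[mu]_y energy_kernel (x, y))%E.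

Lemma gagliardo_kernel_ge0 x y : 0 <= gagliardo_kernel x y.
Proof. by rewrite divr_ge0// powR_ge0. Qed.

Lemma energy_kernel_ge0 xy : (0 <= energy_kernel xy)%E.
Proof. by apply: erestrict_ge0 => ? _; rewrite lee_fin gagliardo_kernel_ge0. Qed.

Lemma energy_density_ge0 x : (0 <= energy_density x)%E.
Proof. by apply: integral_ge0 => y _; exact: energy_kernel_ge0. Qed.

Lemma measurable_energy_domain : measurable energy_domain.
Proof.
have mO := open_measurable_rV oO.
have -> : energy_domain = (Omega `*` Omega) `&`
    (fun xy : rV * rV => tau * dist_set xy.1 (boundary Omega) - enorm (xy.1 - xy.2))
      @^-1` `]0, +oo[.
  apply/seteqP; split => -[x y]; rewrite /energy_domain /= in_itv/= andbT subr_gt0.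
    by move=> [].
  by move=> [[]].
apply: measurableI; first exact: measurableX.
rewrite -[X in measurable X]setTI.
apply: (_ : measurable_fun setT _) => //.
apply: measurable_funB; last exact: measurable_enormB.
apply: measurable_funM => //.
exact: (measurableT_comp (measurable_dist_set (boundary Omega)) measurable_fst).
Qed.

Lemma measurable_energy_kernel : measurable_fun setT energy_kernel.
Proof.
have mO := open_measurable_rV oO.
have mu_ := measurable_fun_within_continuous oO cu.
apply/measurable_restrict => //; first exact: measurable_energy_domain.
rewrite setTI; apply/measurable_EFinP; apply: measurable_funM.
  apply: (measurableT_comp (measurable_powR p)).
  apply: (measurableT_comp (@normr_measurable R setT)).
  apply: measurable_funB.
    apply: (measurable_comp mO _ mu_).
      by move=> _ [xy [Ox _ _] <-].
    exact: measurable_funTS measurable_fst.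
  apply: (measurable_comp mO _ mu_).
    by move=> _ [xy [_ Oy _] <-].
  exact: measurable_funTS measurable_snd.
apply: measurable_funTS; under eq_fun do rewrite -powRN.
exact: (measurableT_comp (measurable_powR _) measurable_enormB).
Qed.

Lemma measurable_gagliardo_kernel x : Omega x ->
  measurable_fun Omega (gagliardo_kernel x : rV -> measurableTypeR R).
Proof.
move=> Ox; apply: measurable_funM.
  apply: (measurableT_comp (measurable_powR p)).
  apply: (measurableT_comp (@normr_measurable R setT)).
  by apply: measurable_funB => //; exact: measurable_fun_within_continuous.
apply: measurable_funTS; under eq_fun do rewrite -powRN.
apply: (measurableT_comp (measurable_powR _)).
exact: (measurableT_comp measurable_enormB (pair1_measurable x)).
Qed.

Lemma measurable_energy_density : measurable_fun setT energy_density.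
Proof.
apply: (@measurable_fun_fubini_tonelli_F _ _ _ _ R mu energy_kernel).
  exact: measurable_energy_kernel.
exact: energy_kernel_ge0.
Qed.

Lemma fractional_energyE :
  fractional_energy delta tau p Omega u = (\int[mu]_x energy_density x)%E.
Proof.
rewrite /fractional_energy integral_mkcond; apply: eq_integral => x _.
rewrite /energy_density patchE; case: ifPn => [/set_mem Ox|xO].
  rewrite integral_mkcond; apply: eq_integral => y _.
  rewrite /energy_kernel !patchE.
  have -> : ((x, y) \in energy_domain) =
      (y \in Omega `&` eball x (tau * dist_set x (boundary Omega))) => //.
  by apply/idP/idP => /set_mem[//= ? ?]; [move=> ?|]; apply/mem_set; split.
rewrite integral0_eq// => y _; rewrite /energy_kernel patchE ifN//.
by apply: contra xO => /set_mem[/= Ox _ _]; exact/mem_set.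
Qed.

Lemma le_energy_density x (B : set rV) : Omega x -> measurable B ->
  B `<=` Omega `&` eball x (tau * dist_set x (boundary Omega)) ->
  (\int[mu]_(y in B) (gagliardo_kernel x y)%:E <= energy_density x)%E.
Proof.
move=> Ox mB BO.
have -> : (\int[mu]_(y in B) (gagliardo_kernel x y)%:E =
    \int[mu]_(y in B) energy_kernel (x, y))%E.
  apply: eq_integral => y /set_mem /BO[Oy xy].
  by rewrite /energy_kernel patchE mem_set.
apply: ge0_subset_integral => //.
- exact: (measurableT_comp measurable_energy_kernel (pair1_measurable x)).
- by move=> y _; exact: energy_kernel_ge0.
Qed.

End energy_density.

(** Either t <= lam, or t = t^(1-p) t^p <= lam^(1-p) t^p. The parameter stays free until all
    contributions of a level are summed. *)
Lemma young_powR {R : realType} (p lam t : R) : 1 <= p -> 0 < lam -> 0 <= t ->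
  t <= lam + lam `^ (1 - p) * t `^ p.
Proof.
move=> p1 l0 t0; have [tl|lt] := leP t lam.
  by rewrite (le_trans tl)// lerDl mulr_ge0// powR_ge0.
have tp0 : 0 < t by exact: lt_trans lt.
apply: (@le_trans _ _ (lam `^ (1 - p) * t `^ p)); last by rewrite lerDr ltW.
have -> : 1 - p = - (p - 1) by rewrite opprB.
rewrite powRN -ler_pdivrMl ?invr_gt0 ?powR_gt0// invrK.
have -> : t `^ p = t `^ (p - 1) * t.
  by rewrite -{3}(powRr1 t0) -powRD ?subrK// (gt_eqF tp0) implybT.
by rewrite ler_wpM2r// ge0_ler_powR ?nnegrE ?subr_ge0// ltW.
Qed.

Lemma ge0_integral_affine d (T : measurableType d) (R : realType)
    (mu : {measure set T -> \bar R}) (D : set T) (f : T -> \bar R) (a k v : R) :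
  measurable D -> mu D = v%:E -> 0 <= a -> 0 <= k ->
  measurable_fun D f -> (forall x, D x -> (0 <= f x)%E) ->
  (\int[mu]_(x in D) (a%:E + k%:E * f x) =
   (a * v)%:E + k%:E * \int[mu]_(x in D) f x)%E.
Proof.
move=> mD Dv a0 k0 mf f0; rewrite ge0_integralD//.
- by rewrite integral_cst// Dv -EFinM ge0_integralZl.
- by move=> x Dx; rewrite mule_ge0// f0.
- exact: emeasurable_funM.
Qed.

Section oscillation.
Context {R : realType} {n : nat}.
Local Notation rV := 'rV[R]_n.
Local Notation mu := (@lebesgue_rV R n).
Variables (delta tau p : R) (Omega : set rV) (u : rV -> R).
Hypotheses (oO : open Omega) (cu : {within Omega, continuous u}).
Hypotheses (n0 : (0 < n)%N) (delta0 : 0 <= delta) (p1 : 1 <= p).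
Local Notation d := (fun z => dist_set z (boundary Omega)).
Local Notation avg r z := (average (cell r (cell_index r z)) u).

Let n1 : 1 <= n%:R :> R. Proof. by rewrite ler1n. Qed.

Lemma cell_average_dist (z : rV) (r c : R) : 0 < r ->
  (forall y, (forall i, `|(z - y) ord0 i| <= r) -> Omega y) ->
  (`|avg r z - c|%:E * (r ^+ n)%:E <=
    \int[mu]_(y in cell r (cell_index r z)) `|u y - c|%:E)%E.
Proof.
move=> r0 zO; rewrite -(lebesgue_cell (cell_index r z) r0).
apply: average_dist; [exact: measurable_cell| |exact: integrable_cell zO].
by rewrite lebesgue_cell// lte_fin exprn_gt0// ltry.
Qed.

(** Points y of the first cell and w of the second are at distance at most 4 n r, so |u y - u w|^p
    is at most (4 n r)^(n + p delta) times the kernel; the depth assumptions put w in the ball over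
    which the energy density at y is taken. Averaging over both cells gives the factor 1 / (r^n
    r'^n). Unequal sides serve to pass from one level to the next. *)
Lemma average_oscillation (z z' : rV) (r r' lam : R) :
  0 < r -> 0 < r' <= r -> 0 < lam -> Omega z -> enorm (z - z') <= 2 * r ->
  8 * n%:R * r <= d z -> 8 * n%:R * r <= tau * d z ->
  (`|avg r z - avg r' z'|%:E <= lam%:E +
    (lam `^ (1 - p) * (4 * n%:R * r) `^ (n%:R + p * delta) /
       (r ^+ n * r' ^+ n))%:E *
    \int[mu]_(y in cell r (cell_index r z))
      energy_density delta tau p Omega u y)%E.
Proof.
move=> r0 /andP[r'0 r'r] l0 Oz zz' rd rtd.
set Q := cell r _; set Q' := cell r' (cell_index r' z').
set M := (4 * n%:R * r) `^ (n%:R + p * delta).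
have mQ : measurable Q by exact: measurable_cell.
have mQ' : measurable Q' by exact: measurable_cell.
have nr0 : r <= n%:R * r by rewrite ler_peMl// ltW.
have nr'0 : n%:R * r' <= n%:R * r by rewrite ler_wpM2l.
have nr_gt0 : 0 < n%:R * r by rewrite (lt_le_trans r0).
have tau0 : 0 < tau.
  have dz0 : 0 < d z by lra.
  by rewrite -(pmulr_lgt0 _ dz0); lra.
have near_z y : (forall i, `|(z - y) ord0 i| <= r) -> enorm (z - y) <= n%:R * r.
  exact: enorm_le.
(* Here |z - z'| <= 2 r <= 2 n r, and the offset inside the second cell costs n r' <= n r. *)
have near_z' y : (forall i, `|(z' - y) ord0 i| <= r') ->
    enorm (z - y) <= 3 * n%:R * r.
  move=> /enorm_le z'y; apply: le_trans (enorm_dist_triangle z' _ _) _.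
  lra.
have in_Omega y : enorm (z - y) <= 3 * n%:R * r -> Omega y.
  move=> zy; apply: (ball_boundary_subset oO Oz); apply: le_lt_trans zy _.
  lra.
have Qz y : Q y -> enorm (z - y) <= n%:R * r.
  by move=> Qy; apply: cell_enorm_le => //; rewrite Qy.
have Q'z y : Q' y -> enorm (z - y) <= 3 * n%:R * r.
  move=> Q'y; apply: near_z' => i; rewrite ltW// cell_coord_lt//.
have QO : Q `<=` Omega by move=> y /Qz zy; apply: in_Omega; lra.
have Q'O : Q' `<=` Omega by move=> y /Q'z zy; apply: in_Omega; lra.
have mO := open_measurable_rV oO.
have mu_ := measurable_fun_within_continuous oO cu.
have dens0 := energy_density_ge0 delta tau p Omega u.
have mdens := measurable_energy_density delta tau p oO cu.
have close y w : Q y -> Q' w -> enorm (y - w) <= 4 * n%:R * r.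
  move=> /Qz zy /Q'z zw; apply: le_trans (enorm_dist_triangle z _ _) _.
  by rewrite enormB; lra.
have kernel_ge y w : Q y -> Q' w ->
    `|u y - u w| `^ p <= M * gagliardo_kernel delta p u y w.
  move=> Qy Qw; rewrite /gagliardo_kernel.
  (* On the diagonal both sides are 0, as 0 to the positive power p is 0. *)
  have [->|yw] := eqVneq y w.
    by rewrite subrr normr0 powR0 ?mul0r ?mulr0// gt_eqF// (lt_le_trans ltr01).
  have yw0 : 0 < enorm (y - w) by rewrite enorm_gt0// subr_eq0.
  rewrite mulrA ler_pdivlMr ?powR_gt0// mulrC ler_wpM2r ?powR_ge0//.
  rewrite ge0_ler_powR ?nnegrE ?enorm_ge0//; last exact: close.
    by rewrite addr_ge0 ?mulr_ge0// (le_trans ler01).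
  by rewrite !mulr_ge0// ltW.
pose K := lam `^ (1 - p) * M / r' ^+ n.
have K0 : 0 <= K by rewrite !mulr_ge0 ?powR_ge0// invr_ge0 exprn_ge0// ltW.
(* Average first over [Q'], at fixed [y], then over [Q]. *)
have step1 y : Q y ->
    (`|u y - avg r' z'|%:E <= lam%:E +
       K%:E * energy_density delta tau p Omega u y)%E.
  move=> Qy; rewrite -(@lee_pmul2r _ (r' ^+ n)%:E) ?lte_fin ?exprn_gt0//.
  rewrite distrC; apply: le_trans (cell_average_dist _ r'0 _) _.
    by move=> w /near_z'/in_Omega.
  apply: (@le_trans _ _ (\int[mu]_(w in Q') (lam%:E + (lam `^ (1 - p) * M)%:E *
      (gagliardo_kernel delta p u y w)%:E)))%E.
    apply: ge0_le_integral => //.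
    - apply/measurable_EFinP; apply: (measurableT_comp (@normr_measurable R setT)).
      by apply: measurable_funB => //; exact: measurable_funS mu_.
    - apply: emeasurable_funD => //; apply: emeasurable_funM => //.
      apply/measurable_EFinP; apply: measurable_funS (mO) Q'O _.
      by apply: measurable_gagliardo_kernel => //; exact: QO.
    - move=> w Q'w; rewrite lee_fin distrC.
      apply: le_trans (young_powR p1 l0 (normr_ge0 _)) _.
      by rewrite lerD2l -mulrA ler_wpM2l ?powR_ge0// kernel_ge.
  rewrite (@ge0_integral_affine _ _ _ _ _ _ _ _ (r' ^+ n))//; first last.
  - by move=> w _; rewrite lee_fin gagliardo_kernel_ge0.
  - apply/measurable_EFinP; apply: measurable_funS (mO) Q'O _.
    by apply: measurable_gagliardo_kernel => //; exact: QO.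
  - by rewrite mulr_ge0 ?powR_ge0.
  - exact: ltW.
  - exact: lebesgue_cell.
  rewrite ge0_muleDl ?lee_fin ?(ltW l0)//; last by rewrite mule_ge0.
  rewrite -EFinM leeD2l// muleAC -EFinM /K mulfVK ?gt_eqF ?exprn_gt0//.
  rewrite lee_wpmul2l ?lee_fin ?mulr_ge0 ?powR_ge0//.
  apply: le_energy_density => //; first exact: QO.
  move=> w Q'w; split; first exact: Q'O.
  apply: (le_lt_trans (close _ _ Qy Q'w)).
  (* [y] is within n r <= d z / 8 of [z], so tau d y is at least 7/8 of 8 n r, that is 7 n r, which
     exceeds the bound 4 n r on the distance from [y] to [w]. *)
  have := dist_set_lip (boundary Omega) z y; have := Qz _ Qy.
  move=> zy dzy; have dy : 7 / 8 * d z <= d y by lra.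
  have := ler_wpM2l (ltW tau0) dy; lra.
have rn0 : 0 < r ^+ n by rewrite exprn_gt0.
rewrite -(@lee_pmul2r _ (r ^+ n)%:E) ?lte_fin//.
apply: le_trans (cell_average_dist _ r0 _) _.
  by move=> w /near_z zw; apply: in_Omega; lra.
apply: (@le_trans _ _ (\int[mu]_(y in Q)
    (lam%:E + K%:E * energy_density delta tau p Omega u y)))%E.
  apply: ge0_le_integral => //.
  - apply/measurable_EFinP; apply: (measurableT_comp (@normr_measurable R setT)).
    by apply: measurable_funB => //; exact: measurable_funS mu_.
  - apply: emeasurable_funD => //; apply: emeasurable_funM => //.
    exact: measurable_funTS.
rewrite (@ge0_integral_affine _ _ _ _ _ _ _ _ (r ^+ n))//; first last.
- exact: measurable_funTS.
- exact: ltW.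
- exact: lebesgue_cell.
rewrite ge0_muleDl ?lee_fin ?(ltW l0)//; last first.
  by rewrite mule_ge0 ?integral_ge0// lee_fin mulr_ge0 ?mulr_ge0 ?powR_ge0//
    invr_ge0 mulr_ge0// exprn_ge0// ltW.
rewrite -EFinM leeD2l// muleAC -EFinM.
suff -> : lam `^ (1 - p) * M / (r ^+ n * r' ^+ n) * r ^+ n = K by [].
by rewrite /K; field; rewrite !gt_eqF ?exprn_gt0.
Qed.

End oscillation.

(** * Chains of cells of one side *)

Section chain.
Context {R : realType} {n : nat}.
Local Notation rV := 'rV[R]_n.
Local Notation mu := (@lebesgue_rV R n).

Definition cube (x : rV) (rho : R) : set rV :=
  [set y | forall i, `|(x - y) ord0 i| < rho].

Lemma cube_box (x : rV) (rho : R) : cube x rho = [set y | forall i,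
  ([set` `]x ord0 i - rho, x ord0 i + rho[] : set R) (y ord0 i)].
Proof.
apply/seteqP; split=> y H i; have := H i; rewrite /= in_itv/= !mxE distrC ltr_distl;
  exact.
Qed.

Lemma measurable_cube x rho : measurable (cube x rho).
Proof.
rewrite cube_box; exact: (@measurable_box _ _ (fun i : 'I_n =>
  [set` `]x ord0 i - rho, x ord0 i + rho[] : set R)).
Qed.

Lemma lebesgue_measure_cube x (rho : R) : 0 < rho ->
  mu (cube x rho) = ((2 * rho) ^+ n)%:E.
Proof.
move=> rho0; rewrite cube_box; apply: (@lebesgue_cube _ _ (fun i : 'I_n =>
  [set` `]x ord0 i - rho, x ord0 i + rho[] : set R)) => // i.
rewrite lebesgue_measure_itv/= lte_fin ifT; last by lra.
by rewrite -EFinB; congr EFin; ring.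
Qed.

Lemma cubeC (x y : rV) (rho : R) : cube x rho y <-> cube y rho x.
Proof. by split=> H i; have := H i; rewrite !mxE distrC. Qed.

Lemma sum_cell_integral (r : R) (s : seq 'rV[int]_n) (B : set rV)
    (f : rV -> \bar R) : 0 < r -> uniq s -> measurable B ->
  measurable_fun setT f -> (forall x, (0 <= f x)%E) ->
  (forall k, k \in s -> cell r k `<=` B) ->
  (\sum_(k <- s) \int[mu]_(x in cell r k) f x <= \int[mu]_(x in B) f x)%E.
Proof.
move=> r0 us mB mf f0 sB.
rewrite -ge0_integral_bigsetU//; first last.
- exact: measurable_funTS.
- exact: trivIset_preimage1.
- by move=> k; exact: measurable_cell.
apply: ge0_subset_integral => //.
- by apply: bigsetU_measurable => k _; exact: measurable_cell.
- exact: measurable_funTS.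
- by move=> y; rewrite -bigcup_seq => -[k /= ks]; exact: sB.
Qed.

Variables (delta tau p : R) (Omega : set rV) (u : rV -> R).
Hypotheses (oO : open Omega) (cu : {within Omega, continuous u}).
Hypotheses (n0 : (0 < n)%N) (delta0 : 0 <= delta) (p1 : 1 <= p).
Local Notation d := (fun z => dist_set z (boundary Omega)).
Local Notation avg r z := (average (cell r (cell_index r z)) u).
Local Notation dens := (energy_density delta tau p Omega u).

(** The coefficient of the energy in [average_oscillation]: [r'] equals [r] along a chain and is
    smaller when the level changes. *)
Definition osc_const (r r' lam : R) : R :=
  lam `^ (1 - p) * (4 * n%:R * r) `^ (n%:R + p * delta) / (r ^+ n * r' ^+ n).

Lemma chain_oscillation (x : rV) (z : nat -> rV) (N : nat) (r rho lam : R) :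
  0 < r -> 0 < lam ->
  (forall k, (k <= N)%N -> Omega (z k)) ->
  (forall k, (k <= N)%N -> 8 * n%:R * r <= d (z k)) ->
  (forall k, (k <= N)%N -> 8 * n%:R * r <= tau * d (z k)) ->
  (forall k, (k <= N)%N -> enorm (x - z k) + r <= rho) ->
  (forall k, (k < N)%N -> enorm (z k - z k.+1) <= 2 * r) ->
  (`|avg r (z 0) - avg r (z N)|%:E <= (N%:R * lam)%:E +
    (osc_const r r lam)%:E * \int[mu]_(y in cube x rho) dens y)%E.
Proof.
move=> r0 l0 Oz dz tdz xz zz.
pose U k := average (cell r k) u.
pose A := osc_const r r lam.
have A0 : 0 <= A.
  by rewrite /A /osc_const !mulr_ge0 ?powR_ge0// invr_ge0 mulr_ge0 ?exprn_ge0 ?ltW.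
pose I k := (\int[mu]_(y in cell r k) dens y)%E.
have I0 k : (0 <= I k)%E by apply: integral_ge0 => y _; exact: energy_density_ge0.
(* The relation depends on cell indices only, not on the points [z k], so it survives when the path
   is shortened. *)
pose e : rel 'rV[int]_n := fun k k' => `[<cell r k `<=` cube x rho /\
  (`|U k - U k'|%:E <= lam%:E + A%:E * I k)%E >].
pose s := [seq cell_index r (z k) | k <- iota 1 N].
have path_e : path e (cell_index r (z 0)) s.
  rewrite /s; apply/(pathP (cell_index r (z 0))) => i.
  rewrite size_map size_iota => iN.
  have -> : nth (cell_index r (z 0)) (cell_index r (z 0) ::
      [seq cell_index r (z k) | k <- iota 1 N]) i = cell_index r (z i).
    case: i iN => [//|i iN]; rewrite /= (nth_map 0) ?size_iota ?(ltnW iN)//.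
    by rewrite nth_iota ?(ltnW iN).
  rewrite (nth_map 0) ?size_iota// nth_iota// add1n.
  apply/asboolP; split.
    move=> y Qy j; rewrite -[x - y](subrKA (z i)) mxE.
    apply: le_lt_trans (ler_normD _ _) _.
    have := coord_le_enorm (x - z i) j; have := xz i (ltnW iN).
    have : `|(z i - y) ord0 j| < r by apply: cell_coord_lt.
    by lra.
  apply: average_oscillation => //; [by rewrite r0 lexx|exact: Oz (ltnW iN)
    |exact: zz|exact: dz (ltnW iN)|exact: tdz (ltnW iN)].
have last_s : last (cell_index r (z 0)) s = cell_index r (z N).
  rewrite /s; case: (N) => [//|N'].
  by rewrite -[X in iota _ X]addn1 iotaD map_cat last_cat/= add1n.
have size_s : size s = N by rewrite size_map size_iota.
(* Each edge is charged to its initial cell, whence [belast]. *)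
have chain k t : path e k t ->
    (`|U k - U (last k t)|%:E <= ((size t)%:R * lam)%:E +
      A%:E * \sum_(k' <- belast k t) I k')%E /\
    {in belast k t, forall k', cell r k' `<=` cube x rho}.
  elim: t k => [|k' t IH] k /=.
    by move=> _; rewrite subrr normr0 mul0r big_nil mule0 adde0; split.
  case/andP => /asboolP[kB Ukk'] /IH[Ut tB]; split; last first.
    by move=> k''; rewrite inE => /predU1P[->//|/tB].
  rewrite big_cons ge0_muleDr//; last exact: sume_ge0.
  rewrite -natr1 mulrDl mul1r (addrC (_ * lam)) EFinD addeACA.
  apply: le_trans (leeD Ukk' Ut); rewrite -EFinD lee_fin.
  by rewrite -(subrKA (U k')) ler_normD.
rewrite -/(U _) -/(U (cell_index r (z N))) -last_s.
(* Without loops the cells of the chain are disjoint, so that their energies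
   add up to at most the energy of the cube. *)
case/shortenP: path_e => s' path_s' uniq_s' /uniq_leq_size size_s'.
have [Us' s'B] := chain _ _ path_s'; apply: le_trans Us' _.
have us' : uniq (belast (cell_index r (z 0)) s').
  by move: uniq_s'; rewrite lastI rcons_uniq => /andP[].
apply: leeD.
  rewrite lee_fin; apply: ler_wpM2r; first exact: ltW.
  rewrite ler_nat -size_s; apply: size_s'.
  by case/andP: uniq_s'.
rewrite lee_wpmul2l ?lee_fin//; apply: sum_cell_integral => //.
- exact: measurable_cube.
- exact: measurable_energy_density.
- exact: energy_density_ge0.
Qed.

End chain.

(** * John curves *)

Lemma within_continuous_dist {R : realType} {U V : normedModType R} (A : set U)
    (f : U -> V) (x : U) (e : R) : {within A, continuous f} -> A x -> 0 < e ->
  exists2 r, 0 < r & forall y, A y -> `|x - y| < r -> `|f x - f y| < e.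
Proof.
move=> /subspace_continuousP/(_ x) + Ax e0 => /(_ Ax (ball (f x) e)).
move=> /(_ (nbhsx_ballx _ _ e0)) /nbhs_ballP[r /= r0 rA]; exists r => // y Ay xy.
by have := rA y; rewrite -!ball_normE /= => /(_ xy Ay).
Qed.

Section arclength.
Context {R : realType} {n : nat}.
Local Notation rV := 'rV[R]_n.

(** Uniform continuity on a compact interval, through the near-covering form of compactness: each t
    has a neighbourhood over which, for all large m, a displacement of at most 1/(m+1) moves the
    image by at most eta. *)
Lemma path_uniform_step (g : R -> rV) (eta : R) : 0 < eta ->
  {within `[0, 1], continuous g} ->
  exists m : nat, forall k, (k < m.+1)%N ->
    enorm (g (k%:R / m.+1%:R) - g (k.+1%:R / m.+1%:R)) <= eta.
Proof.
move=> eta0 cg.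
have := segment_compact (a := 0 : R) (b := 1).
move=> /compact_near_coveringP.
move=> /(_ nat \oo (fun m t => 0 <= t <= 1 -> forall t', 0 <= t' <= 1 ->
  `|t - t'| <= m.+1%:R^-1 -> enorm (g t - g t') <= eta)) cov.
have [t /= t01|m _ mg] := cov _ _.
  have eta2 : 0 < eta / 2 / n.+1%:R by rewrite !divr_gt0.
  have [e e0 ge] := within_continuous_dist cg t01 eta2.
  have e20 : 0 < e / 2 by rewrite divr_gt0.
  have genorm t' : t' \in `[0, 1] -> `|t - t'| < e -> enorm (g t - g t') <= eta / 2.
    move=> t'01 /(ge _ t'01) /ltW; rewrite ler_pdivlMr// mulrC => gt.
    apply: le_trans (enorm_le_norm _) _; apply: le_trans gt.
    by rewrite ler_wpM2r// ler_nat.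
  exists (ball t (e / 2), [set m | m.+1%:R^-1 < e / 2]); first split => /=.
  - exact: nbhsx_ballx.
  - exact: near_infty_natSinv_lt (PosNum e20).
  move=> [t' m] /= [+ me] t'01 t'' t''01 t't''; rewrite -ball_normE /= => tt'.
  apply: le_trans (enorm_dist_triangle (g t) _ _) _.
  rewrite enormB (splitr eta) lerD// genorm ?in_itv//=; first by lra.
  apply: le_lt_trans (ler_distD t' t t'') _.
  by rewrite (splitr e) ltrD// (le_lt_trans t't'').
exists m => k km.
have k01 : 0 <= (k%:R / m.+1%:R : R) <= 1.
  by apply/andP; split; rewrite ?divr_ge0// ler_pdivrMr// mul1r ler_nat ltnW.
have k101 : 0 <= (k.+1%:R / m.+1%:R : R) <= 1.
  by apply/andP; split; rewrite ?divr_ge0// ler_pdivrMr// mul1r ler_nat.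
apply: (mg m (leqnn m)); rewrite /= ?in_itv/= //.
by rewrite -mulrBl -natr1 opprD addNKr normrM normrN1 mul1r ger0_norm.
Qed.

(** The points k/m with 1 <= k <= i partition [0, i/m], so their polygonal line is among those of
    which the length is the supremum. *)
Lemma discrete_length_le (g : R -> rV) (m i : nat) : (0 < i <= m)%N ->
  ((\sum_(0 <= k < i) enorm (g (k%:R / m%:R) - g (k.+1%:R / m%:R)))%:E <=
    curve_length 0 (i%:R / m%:R) g)%E.
Proof.
move=> /andP[i0 im]; apply: ereal_sup_ubound => /=.
have m0 : 0 < m%:R :> R by rewrite ltr0n (leq_trans i0).
pose l := [seq k%:R / m%:R : R | k <- iota 1 i].
have nthl k : (k <= i)%N ->
    nth (i%:R / m%:R : R) (0 :: l) k = k%:R / m%:R.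
  case: k => [|k] ki /=; first by rewrite mul0r.
  by rewrite (nth_map 0) ?size_iota// nth_iota.
have sl : size l = i by rewrite size_map size_iota.
exists l.
  split.
    apply/(pathP (i%:R / m%:R)) => k; rewrite sl => ki.
    rewrite (nthl _ (ltnW ki)) -[nth _ l k]/(nth (i%:R / m%:R) (0 :: l) k.+1).
    by rewrite nthl// ltr_pM2r ?invr_gt0// ltr_nat.
  by rewrite (last_nth (i%:R / m%:R)) sl nthl.
rewrite sl; congr EFin; apply: eq_big_nat => k /andP[_ ki].
rewrite -[nth _ l k]/(nth (i%:R / m%:R) (0 :: l) k.+1).
by rewrite !nthl ?(ltnW ki)// enormB.
Qed.

Local Notation d Omega := (fun z : rV => dist_set z (boundary Omega)).

(* A discrete substitute for the arc-length parametrization of the John curve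
   from [x] to [x0], extended by [x0] up to length [L]. *)
Lemma approximate_arclength (s C L eta : R) (Omega : set rV) (x0 x : rV) g :
  0 < s -> 0 <= C -> 0 < L -> L `^ s = C * d Omega x0 -> 0 < eta ->
  john_curve s C Omega x0 x g ->
  exists P : R -> rV,
    [/\ P L = x0,
        forall t, 0 <= t -> Omega (P t) /\ enorm (x - P t) <= t,
        forall t t', 0 <= t <= t' -> enorm (P t - P t') <= t' - t + eta &
        forall t, eta <= t <= L -> (t - eta) `^ s <= C * d Omega (P t)].
Proof.
move=> s0 C0 L0 Ls eta0 [[cg gO] _ g0 g1 gd].
have [m0 step] := path_uniform_step eta0 cg; pose m := m0.+1.
pose p k := g (k%:R / m%:R).
pose l i := \sum_(0 <= k < i) enorm (p k - p k.+1).
have lS i : l i.+1 = l i + enorm (p i - p i.+1) by rewrite /l big_nat_recr.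
have l0 : l 0 = 0 by rewrite /l big_geq.
have pl i j : (i <= j)%N -> enorm (p i - p j) <= l j - l i.
  move=> /subnK <-; elim: (j - i)%N => [|k IH]; first by rewrite !subrr enorm0.
  rewrite addSn lS addrAC; apply: le_trans (enorm_dist_triangle (p (k + i)%N) _ _) _.
  by rewrite lerD2r.
have l_homo i j : (i <= j)%N -> l i <= l j.
  by move=> /pl ij; rewrite -subr_ge0 (le_trans _ ij)// enorm_ge0.
have l_ge0 i : 0 <= l i by rewrite -l0 l_homo.
have l_john i : (i <= m)%N -> l i `^ s <= C * d Omega (p i).
  (* The John condition concerns t > 0 only; at the start the length is 0. *)
  case: i => [|i] im.
    by rewrite l0 powR0 ?gt_eqF// mulr_ge0// dist_set_ge0.
  have im0 : 0 < (i.+1%:R / m%:R : R) by rewrite divr_gt0.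
  have im1 : (i.+1%:R / m%:R : R) <= 1 by rewrite ler_pdivrMr// mul1r ler_nat.
  have := gd (i.+1%:R / m%:R); rewrite im0 im1 => /(_ isT).
  rewrite -lee_fin; apply: le_trans; rewrite -poweR_EFin.
  have ll := discrete_length_le g (m := m) (i := i.+1).
  apply: gt0_ler_poweR; rewrite ?(ltW s0)//; last exact: ll.
    by rewrite in_itv/= lee_fin l_ge0 leey.
  by rewrite in_itv/= leey andbT (le_trans _ (ll im))// lee_fin l_ge0.
have p0 : p 0 = x by rewrite /p mul0r.
have pm : p m = x0 by rewrite /p divff ?pnatr_eq0.
(* The John condition at the last vertex x0 reads (l m)^s <= C d x0 = L^s. *)
have lmL : l m <= L.
  rewrite leNgt; apply/negP => /(gt0_ltr_powR s0).
  rewrite !nnegrE => /(_ (ltW L0) (l_ge0 m)); rewrite Ls -pm.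
  by rewrite ltNge l_john.
(* [idx t] is the last vertex reached within discrete length t; it is m, giving the point x0, once t
   is at least the total length. *)
have /choice[idx idxP] (t : R) : exists i, 0 <= t ->
    [/\ (i <= m)%N, l i <= t & (i < m)%N -> t < l i.+1].
  have [t0|/negP t0] := boolP (0 <= t); last by exists 0.
  have ex : exists i, (i <= m)%N && (l i <= t) by exists 0; rewrite l0 t0.
  have ub i : (i <= m)%N && (l i <= t) -> (i <= m)%N by case/andP.
  have [i /andP[im lit] imax] := ex_maxnP ex ub; exists i => _; split => // im'.
  by rewrite ltNge; apply/negP => lt; have := imax i.+1; rewrite im' lt ltnn => /(_ isT).
have p_Omega i : (i <= m)%N -> Omega (p i).
  move=> im; apply: gO; exists (i%:R / m%:R) => //=.
  by rewrite in_itv/= divr_ge0//= ler_pdivrMr// mul1r ler_nat.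
have p_step i : (i < m)%N -> l i.+1 <= l i + eta.
  by move=> im; rewrite lS lerD2l; exact: step.
exists (p \o idx); split => /=.
- have [im lL Ll] := idxP L (ltW L0); rewrite -pm; congr p.
  apply/eqP; rewrite eqn_leq im leqNgt; apply/negP => im'.
  by have := Ll im'; rewrite ltNge (le_trans _ lmL)// l_homo.
- move=> t t0; have [im lt _] := idxP t t0; split; first exact: p_Omega.
  by rewrite -p0; apply: le_trans (pl _ _ (leq0n _)) _; rewrite l0 subr0.
- move=> t t' /andP[t0 tt'].
  have [im lt tl] := idxP t t0; have [im' lt' tl'] := idxP t' (le_trans t0 tt').
  have ii' : (idx t <= idx t')%N.
    rewrite leqNgt; apply/negP => i'i.
    have := tl' (leq_trans i'i im); rewrite ltNge => /negP; apply.
    by apply: le_trans tt'; apply: le_trans lt; exact: l_homo.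
  have [im1|mi] := ltnP (idx t) m.
    have := pl _ _ ii'; have := p_step _ im1; have := tl im1; lra.
  have -> : idx t = idx t' by apply/eqP; rewrite eqn_leq ii' (leq_trans im').
  by rewrite subrr enorm0 addr_ge0 ?subr_ge0// ltW.
(* Before the last vertex, t < l (idx t) + eta, so the John condition at that vertex applies with
   the loss eta; at the last vertex, t <= L and L^s = C d x0 suffice. *)
- move=> t /andP[et tL]; have t0 : 0 <= t by apply: le_trans et; exact: ltW.
  have [im lt tl] := idxP t t0.
  have [im'|mi] := ltnP (idx t) m.
    apply: le_trans (l_john _ im); rewrite ge0_ler_powR ?nnegrE ?subr_ge0 ?(ltW s0)//.
    by rewrite lerBlDr; apply: le_trans (p_step _ im'); rewrite ltW// tl.
  have -> : idx t = m by apply/eqP; rewrite eqn_leq im.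
  rewrite pm -Ls ge0_ler_powR ?nnegrE ?subr_ge0 ?(ltW s0) ?(ltW L0)//.
  by rewrite lerBlDr (le_trans tL)// lerDl ltW.
Qed.

End arclength.

Lemma powR_exprn {R : realType} (x s : R) (j : nat) : 0 <= x ->
  (x ^+ j) `^ s = (x `^ s) ^+ j.
Proof. by move=> x0; rewrite -powR_mulrn// powRAC powR_mulrn// powR_ge0. Qed.

(* The minimum over [lam] is attained, up to a factor, at [lam = (b / a)^(1/p)]. *)
Lemma optimize_young {R : realType} (p a b X : R) : 1 <= p -> 0 < a -> 0 <= b ->
  (forall lam, 0 < lam -> X <= a * lam + b * lam `^ (1 - p)) ->
  X <= 2 * (a `^ (1 - p^-1) * b `^ p^-1).
Proof.
(* For b = 0 there is no minimizer; lam tends to 0 instead. *)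
move=> p1 a0; rewrite le_eqVlt => /predU1P[<-|b0] H.
  rewrite powR0 ?mulr0 ?invr_eq0 ?gt_eqF ?(lt_le_trans ltr01)//.
  apply/ler_addgt0Pl => e e0; have ea : 0 < e / a by rewrite divr_gt0.
  have := H _ ea; rewrite mul0r addr0 mulrCA divff ?gt_eqF// mulr1; lra.
have ba0 : 0 < b / a by rewrite divr_gt0.
apply: le_trans (H _ (powR_gt0 p^-1 ba0)) _; rewrite le_eqVlt; apply/orP; left.
have p0 : p != 0 by rewrite gt_eqF// (lt_le_trans ltr01).
have eb : (b / a) `^ p^-1 = b `^ p^-1 / a `^ p^-1.
  by rewrite powRM ?invr_ge0 ?ltW// -(powR_inv1 (ltW a0)) -powRrM mulN1r powRN.
have -> : ((b / a) `^ p^-1) `^ (1 - p) = (b / a) `^ p^-1 / (b / a).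
  by rewrite -powRrM mulrBr mulr1 mulVf// powRB ?(gt_eqF ba0) ?implybT// powRr1// ltW.
rewrite powRB ?(gt_eqF a0) ?implybT// powRr1 ?ltW// eb; apply/eqP; field.
by rewrite !gt_eqF ?powR_gt0.
Qed.

(** * Pointwise estimate along a John curve *)

Section pointwise.
Context {R : realType} {n : nat}.
Local Notation rV := 'rV[R]_n.
Local Notation mu := (@lebesgue_rV R n).

(** Both coefficients scale like r^(n + p delta) / r^(2n) = r^(p delta - n). The smaller second cell
    costs a factor theta^(-n) >= 1, which also dominates the first coefficient, whence 2 /
    theta^n. *)
Lemma osc_const_sum (delta p r theta lam : R) : 0 < r -> 0 < theta <= 1 ->
  osc_const (n := n) delta p r r lam + osc_const (n := n) delta p r (theta * r) lam <=
  2 / theta ^+ n * (4 * n%:R) `^ (n%:R + p * delta) * r `^ (p * delta - n%:R) *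
    lam `^ (1 - p).
Proof.
move=> r0 /andP[t0 t1].
have rE : r `^ (n%:R + p * delta) = r `^ (p * delta - n%:R) * r ^+ n * r ^+ n.
  rewrite -powR_mulrn ?ltW// -!powRD; [|by rewrite (gt_eqF r0) implybT..].
  by congr powR; ring.
have rn0 : 0 < r ^+ n by rewrite exprn_gt0.
have tn0 : 0 < theta ^+ n by rewrite exprn_gt0.
rewrite /osc_const exprMn (powRM _ (mulr_ge0 (ler0n _ 4) (ler0n _ n)) (ltW r0)) rE.
set A := _ `^ (1 - p); set B := (_ * n%:R) `^ _; set D := _ `^ (p * delta - _).
have ABD0 : 0 <= A * B * D by rewrite !mulr_ge0 ?powR_ge0.
have -> : A * (B * (D * r ^+ n * r ^+ n)) / (r ^+ n * r ^+ n) = A * B * D.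
  by field; rewrite gt_eqF.
have -> : A * (B * (D * r ^+ n * r ^+ n)) / (r ^+ n * (theta ^+ n * r ^+ n)) =
    A * B * D / theta ^+ n.
  by field; rewrite !gt_eqF.
have -> : 2 / theta ^+ n * B * D * A = A * B * D / theta ^+ n + A * B * D / theta ^+ n.
  by field; rewrite gt_eqF.
rewrite lerD2r ler_peMr// invf_ge1//.
by rewrite exprn_ile1 ?(ltW t0).
Qed.

Variables (delta tau p s C L a : R) (Omega : set rV) (x0 : rV) (u : rV -> R).
Local Notation d := (fun z => dist_set z (boundary Omega)).
Local Notation avg r z := (average (cell r (cell_index r z)) u).
Local Notation dens := (energy_density delta tau p Omega u).

Let theta : R := 2^-1 `^ s.
Let h j : R := L * 2^-1 ^+ j.
Let r j : R := a * theta ^+ j.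
(** The depth that the John condition guarantees at arc length L / 4 = h 2. At arc length [h j.+2]
    it becomes [b * theta ^+ j], of which [r j] is a fixed multiple. *)
Let b : R := (L / 4) `^ s / C.

(* [r j] decays like [h j `^ s], the John lower bound for the distance to the
   boundary at arc length [h j]. *)
Definition level_energy (j : nat) (x : rV) : R :=
  fine (\int[mu]_(y in cube x (4 * h j)) dens y).

(** Growth per level of the bound in [level_step]: 2^-1 / theta = 2^(s-1) for the number of cells
    and theta^(p delta - n) for the energy coefficient, each with its exponent from
    [optimize_young]. *)
Definition level_ratio : R :=
  (2^-1 / theta) `^ (1 - p^-1) * (theta `^ (p * delta - n%:R)) `^ p^-1.

(** The bound of [optimize_young] at level 0: 2 + L / (2 a) dominates the number of steps plus one,
    and the second base is the constant of [osc_const_sum] at r = a. *)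
Definition level_const : R :=
  2 * ((2 + L / (2 * a)) `^ (1 - p^-1) *
  (2 / theta ^+ n * (4 * n%:R) `^ (n%:R + p * delta) * a `^ (p * delta - n%:R))
    `^ p^-1).

Hypotheses (oO : open Omega) (cu : {within Omega, continuous u}).
Hypotheses (n0 : (0 < n)%N) (delta0 : 0 <= delta) (p1 : 1 <= p) (s1 : 1 <= s).
Hypotheses (C0 : 0 < C) (L0 : 0 < L) (Ls : L `^ s = C * d x0).
Hypotheses (tau0 : 0 < tau) (a0 : 0 < a) (aL : 4 * a <= L).
Hypotheses (ab : 8 * n%:R * a <= b) (atb : 8 * n%:R * a <= tau * b).
Hypothesis fin_energy : (\int[mu]_y dens y < +oo)%E.

Let s0 : 0 < s. Proof. exact: lt_le_trans s1. Qed.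

Let half_gt0 : 0 < 2^-1 :> R. Proof. by rewrite invr_gt0. Qed.

Let theta_gt0 : 0 < theta. Proof. exact: powR_gt0. Qed.

Let theta_le : theta <= 2^-1.
Proof.
rewrite /theta -[leRHS](powRr1 (ltW half_gt0)) ger_powR//.
by rewrite half_gt0 invf_le1// ler1n.
Qed.

Let theta_le1 : theta <= 1. Proof. by move: theta_le; lra. Qed.

Let h_gt0 j : 0 < h j. Proof. by rewrite mulr_gt0// exprn_gt0. Qed.

Let hS j : h j = 2 * h j.+1. Proof. by rewrite /h exprS; field. Qed.

Let r_gt0 j : 0 < r j. Proof. by rewrite mulr_gt0// exprn_gt0. Qed.

Let rS j : r j.+1 = theta * r j. Proof. by rewrite /r exprS mulrCA. Qed.

Let r_le_h j : 4 * r j <= h j.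
Proof.
rewrite /r /h mulrA ler_pM ?mulr_ge0 ?exprn_ge0 ?(ltW theta_gt0) ?(ltW a0)//.
by rewrite lerXn2r ?nnegrE ?(ltW theta_gt0) ?(ltW half_gt0).
Qed.

Let h_homo i j : (i <= j)%N -> h j <= h i.
Proof.
by move=> ij; rewrite ler_pM2l// ler_wiXn2l// ?(ltW half_gt0)// invf_le1// ler1n.
Qed.

Let r_homo i j : (i <= j)%N -> r j <= r i.
Proof. by move=> ij; rewrite ler_pM2l// ler_wiXn2l// ltW. Qed.

Let john_scale j : (h j.+2) `^ s = C * (b * theta ^+ j).
Proof.
have -> : h j.+2 = L / 4 * 2^-1 ^+ j by rewrite /h !exprS; field.
rewrite powRM ?divr_ge0 ?exprn_ge0 ?(ltW half_gt0) ?(ltW L0)// powR_exprn ?(ltW half_gt0)//.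
by rewrite /b; field; rewrite gt_eqF.
Qed.

Let level_fin j x : (\int[mu]_(y in cube x (4 * h j)) dens y)%E =
  (level_energy j x)%:E.
Proof.
rewrite /level_energy fineK// ge0_fin_numE; last first.
  by apply: integral_ge0 => y _; exact: energy_density_ge0.
apply: le_lt_trans fin_energy; apply: ge0_subset_integral => //.
- exact: measurable_cube.
- exact: measurable_energy_density.
- by move=> y _; exact: energy_density_ge0.
Qed.

Lemma level_energy_ge0 j x : 0 <= level_energy j x.
Proof. by rewrite fine_ge0// integral_ge0// => y _; exact: energy_density_ge0. Qed.

Section along_curve.
Variables (x : rV) (P : R -> rV) (J : nat) (eta : R).
Hypotheses (eta_r : eta <= r J) (eta_h : eta <= h J.+2).
Hypotheses (P_in : forall t, 0 <= t -> Omega (P t) /\ enorm (x - P t) <= t).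
Hypothesis P_lip : forall t t', 0 <= t <= t' -> enorm (P t - P t') <= t' - t + eta.
Hypothesis P_john : forall t, eta <= t <= L -> (t - eta) `^ s <= C * d (P t).

(** The loss [eta] is at most [h j.+2], half of [h j.+1], so t - eta >= h j.+2 and the John
    condition gives depth b theta^j, which [ab] and [atb] compare with 8 n r_j. *)
Let P_deep j t : (j <= J)%N -> h j.+1 <= t <= L ->
  8 * n%:R * r j <= d (P t) /\ 8 * n%:R * r j <= tau * d (P t).
Proof.
move=> jJ /andP[ht tL].
have eh : eta <= h j.+2 by apply: le_trans eta_h _; apply: h_homo.
have ht2 : h j.+2 <= t - eta by have := hS j.+1; lra.
have et : eta <= t <= L by rewrite tL andbT; have := h_gt0 j.+2; lra.
have bd : b * theta ^+ j <= d (P t).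
  rewrite -(ler_pM2l C0) -john_scale; apply: le_trans (P_john et).
  by rewrite ge0_ler_powR ?nnegrE ?(ltW s0) ?(ltW (h_gt0 _))// (le_trans _ ht2) ?ltW.
rewrite /r mulrA; split.
  by apply: le_trans bd; rewrite ler_wpM2r// exprn_ge0// ltW.
apply: (@le_trans _ _ (tau * (b * theta ^+ j))); last by rewrite ler_pM2l.
by rewrite mulrA ler_wpM2r// exprn_ge0// ltW.
Qed.

(** The arc from length h j.+1 to h j is cut into N steps of length at most r j; as eta <= r j,
    consecutive points are within 2 r j and [chain_oscillation] applies. One more oscillation,
    between the cells of sides r j and r j.+1 at the common point P (h j.+1), reaches the next
    level. *)
Lemma level_step j : (j < J)%N ->
  `|avg (r j) (P (h j)) - avg (r j.+1) (P (h j.+1))| <=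
  level_const * level_ratio ^+ j * level_energy j x `^ p^-1.
Proof.
move=> jJ; have jJ' := ltnW jJ.
pose N := (Num.truncn (h j.+1 / r j)).+1.
have N0 : 0 < N%:R :> R by rewrite ltr0n.
have Nh : h j.+1 / N%:R <= r j.
  by rewrite ler_pdivrMr// mulrC -ler_pdivrMr// ltW// truncnS_gt.
pose sigma := 2^-1 / theta.
have sigma0 : 0 < sigma by rewrite divr_gt0.
have sigma1 : 1 <= sigma by rewrite ler_pdivlMr// mul1r.
(* N steps along the arc and one change of side; h j.+1 / r j is L / (2 a) times 2^(j(s-1)). *)
have NE : N%:R + 1 <= (2 + L / (2 * a)) * sigma ^+ j.
  have : N%:R <= 1 + h j.+1 / r j.
    by rewrite /N -natr1 addrC lerD2l truncn_le// divr_ge0// ltW.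
  have -> : h j.+1 / r j = L / (2 * a) * sigma ^+ j.
    rewrite /h /r /sigma exprS expr_div_n; field.
    by rewrite !gt_eqF ?exprn_gt0.
  have := exprn_ege1 j sigma1; nra.
have hL : h j <= L by apply: le_trans (h_homo (leq0n j)) _; rewrite /h expr0 mulr1.
pose t k : R := h j.+1 * (1 + k%:R / N%:R).
have t_range k : (k <= N)%N -> h j.+1 <= t k <= h j.
  move=> kN; have kN1 : (k%:R / N%:R : R) <= 1 by rewrite ler_pdivrMr// mul1r ler_nat.
  have kN0 : 0 <= (k%:R / N%:R : R) by rewrite divr_ge0.
  rewrite /t (hS j) ler_peMr ?(ltW (h_gt0 _)) ?lerDl//=.
  by rewrite [leLHS]mulrC ler_pM2r ?lerD2l.
have t0 k : 0 <= t k by rewrite mulr_ge0 ?addr_ge0 ?divr_ge0// ltW.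
have tN : t N = h j by rewrite /t divff ?gt_eqF// (hS j); ring.
have t00 : t 0%N = h j.+1 by rewrite /t mul0r addr0 mulr1.
have deep k : (k <= N)%N ->
    8 * n%:R * r j <= d (P (t k)) /\ 8 * n%:R * r j <= tau * d (P (t k)).
  move=> /t_range/andP[? th]; apply: P_deep => //; apply/andP; split=> //.
  exact: le_trans hL.
have eta_rj : eta <= r j by apply: le_trans eta_r _; apply: r_homo.
have rh := r_le_h j.
have near k : (k <= N)%N -> enorm (x - P (t k)) + r j <= 4 * h j.
  move=> /t_range/andP[_ th]; have [_] := P_in (t0 k); have := h_gt0 j; lra.
pose G := level_energy j x.
have G0 : 0 <= G by exact: level_energy_ge0.
have step lam : 0 < lam -> `|avg (r j) (P (h j)) - avg (r j.+1) (P (h j.+1))| <=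
    (N%:R + 1) * lam + (osc_const (n := n) delta p (r j) (r j) lam +
      osc_const (n := n) delta p (r j) (theta * r j) lam) * G.
  move=> lam0.
  have chain := @chain_oscillation _ _ delta tau p _ _ oO cu n0 delta0 p1 x
    (P \o t) N (r j) (4 * h j) lam (r_gt0 j) lam0.
  have {}chain : `|avg (r j) (P (h j.+1)) - avg (r j) (P (h j))| <=
      N%:R * lam + osc_const (n := n) delta p (r j) (r j) lam * G.
    rewrite -lee_fin EFinD [X in (_ + X)%E]EFinM /G -level_fin.
    rewrite /= t00 tN in chain; apply: chain => k kN.
    - by have [] := P_in (t0 k).
    - by have [] := deep _ kN.
    - by have [] := deep _ kN.
    - exact: near.
    - have tt : 0 <= t k <= t k.+1.
        by rewrite t0 ler_wpM2l ?(ltW (h_gt0 _))// lerD2l ler_pM2r ?invr_gt0// ler_nat.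
      apply: le_trans (P_lip tt) _; rewrite mulr2n mulrDl !mul1r lerD//.
      apply: le_trans Nh; rewrite /t -mulrBr; rewrite -natr1 le_eqVlt; apply/orP; left.
      by apply/eqP; field; rewrite gt_eqF.
  have trans : `|avg (r j) (P (h j.+1)) - avg (r j.+1) (P (h j.+1))| <=
      lam + osc_const (n := n) delta p (r j) (theta * r j) lam * G.
    rewrite -lee_fin EFinD [X in (_ + X)%E]EFinM /G -level_fin -rS.
    have d0 := deep 0%N isT; rewrite t00 in d0.
    have O0 := (P_in (t0 0%N)).1; rewrite t00 in O0.
    have near0 := near 0%N isT; rewrite t00 in near0.
    have rjS : r j.+1 <= r j by exact: r_homo.
    apply: le_trans (average_oscillation oO cu n0 delta0 p1 _ _ lam0 O0 _ d0.1 d0.2) _ => //.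
    - by rewrite r_gt0.
    - by rewrite subrr enorm0 mulr_ge0// ltW.
    rewrite leeD2l// lee_wpmul2l//.
      by rewrite lee_fin mulr_ge0 ?mulr_ge0 ?powR_ge0// invr_ge0 mulr_ge0// exprn_ge0// ltW.
    apply: ge0_subset_integral => //.
    - exact: measurable_cell.
    - exact: measurable_cube.
    - by apply: measurable_funTS; exact: measurable_energy_density.
    - by move=> y _; exact: energy_density_ge0.
    move=> y Qy i; rewrite -[x - y](subrKA (P (h j.+1))) mxE.
    apply: le_lt_trans (ler_normD _ _) _.
    have := coord_le_enorm (x - P (h j.+1)) i.
    have : `|(P (h j.+1) - y) ord0 i| < r j by apply: cell_coord_lt.
    lra.
  rewrite -[_ - avg (r j.+1) _](subrKA (avg (r j) (P (h j.+1)))).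
  apply: le_trans (ler_normD _ _) _; rewrite distrC in chain; lra.
set K1 := 2 + L / (2 * a).
set K3 := 2 / theta ^+ n * (4 * n%:R) `^ (n%:R + p * delta) * a `^ (p * delta - n%:R).
set omega := theta `^ (p * delta - n%:R).
have K10 : 0 < K1 by rewrite addr_gt0// divr_gt0// mulr_gt0.
have K30 : 0 <= K3 by rewrite !mulr_ge0 ?powR_ge0// invr_ge0 exprn_ge0// ltW.
have omega0 : 0 <= omega by exact: powR_ge0.
have := @optimize_young _ p (K1 * sigma ^+ j) (K3 * omega ^+ j * G)
  `|avg (r j) (P (h j)) - avg (r j.+1) (P (h j.+1))| p1.
rewrite mulr_gt0 ?exprn_gt0// (mulr_ge0 (mulr_ge0 K30 _) G0) ?exprn_ge0// => /(_ isT isT).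
move=> opt; apply: le_trans (opt _) _ => [lam lam0|].
  apply: le_trans (step _ lam0) _; apply: lerD.
    by rewrite ler_wpM2r// ltW.
  rewrite mulrAC ler_wpM2r//; apply: le_trans (osc_const_sum _ _ _ (r_gt0 j) _) _.
    by rewrite theta_gt0.
  rewrite ler_wpM2r ?powR_ge0// /r.
  rewrite (powRM _ (ltW a0) (exprn_ge0 j (ltW theta_gt0))).
  by rewrite (powR_exprn _ _ (ltW theta_gt0)) !mulrA.
rewrite /level_const -/K1 -/K3 /level_ratio -/sigma -/omega.
have sj := exprn_ge0 j (ltW sigma0); have oj := exprn_ge0 j omega0.
rewrite (powRM _ (ltW K10) sj) (powRM _ (mulr_ge0 K30 oj) G0) (powRM _ K30 oj).
rewrite (powR_exprn _ _ (ltW sigma0)) (powR_exprn _ _ omega0) exprMn -/G.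
by rewrite le_eqVlt; apply/orP; left; apply/eqP; ring.
Qed.

End along_curve.

Let h_small (rho : R) : 0 < rho -> exists J, (n%:R + 1) * h J < rho.
Proof.
move=> rho0; exists (Num.truncn ((n%:R + 1) * L / rho)).+1.
set J := _.+1; rewrite /h mulrA exprVn ltr_pdivrMr ?exprn_gt0// [ltRHS]mulrC -ltr_pdivrMr//.
apply: (@lt_trans _ _ J%:R); first exact: truncnS_gt.
by rewrite -natrX ltr_nat ltn_expl.
Qed.

(** Telescoping over the levels 0 to J: the cell of level 0 is the fixed one since h 0 = L and P L =
    x0, while for J large the last cell is near x, where continuity brings its average close to u x.
    J and the discretized curve depend on the error e, but the bound K does not. *)
Lemma pointwise_bound (x : rV) g (K : R) :
  Omega x -> john_curve s C Omega x0 x g ->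
  (forall J, \sum_(0 <= j < J)
    level_const * level_ratio ^+ j * level_energy j x `^ p^-1 <= K) ->
  `|u x - avg a x0| <= K.
Proof.
move=> Ox john sumK; apply/ler_addgt0Pr => e e0.
have [rho1 rho10 urho] := within_continuous_dist cu Ox e0.
have /nbhs_ballP[rho2 /= rho20 Orho] : nbhs x Omega by exact: open_nbhs_nbhs.
have rho0 : 0 < Num.min rho1 rho2 by rewrite lt_min rho10.
(* P (h J) is within h J of x, and the points of its cell are within n r J <= n h J of it: hence the
   factor n + 1 in [h_small]. *)
have [J hJ] := h_small rho0.
pose eta := Num.min (r J) (h J.+2).
have eta0 : 0 < eta by rewrite lt_min r_gt0 h_gt0.
have eta_r : eta <= r J by rewrite ge_min lexx.
have eta_h : eta <= h J.+2 by rewrite ge_min lexx orbT.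
have [P [PL P_in P_lip P_john]] :=
  approximate_arclength s0 (ltW C0) L0 Ls eta0 john.
have step := level_step eta_r eta_h P_in P_lip P_john.
have telescope i : (i <= J)%N -> `|avg a x0 - avg (r i) (P (h i))| <=
    \sum_(0 <= j < i) level_const * level_ratio ^+ j * level_energy j x `^ p^-1.
  elim: i => [_|i IH iJ].
    by rewrite /h /r !expr0 !mulr1 PL subrr normr0 big_geq.
  rewrite big_nat_recr//= -(subrKA (avg (r i) (P (h i)))).
  by apply: le_trans (ler_normD _ _) _; rewrite lerD ?step ?IH ?(ltnW iJ).
have close y : (forall i, `|(P (h J) - y) ord0 i| <= r J) ->
    Omega y /\ `|u x - u y| < e.
  move=> /enorm_le Py; have [_ xP] := P_in _ (ltW (h_gt0 J)).
  have xy : `|x - y| < Num.min rho1 rho2.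
    apply: le_lt_trans (norm_le_enorm _) _.
    apply: le_lt_trans (enorm_dist_triangle (P (h J)) _ _) _.
    apply: le_lt_trans hJ; rewrite mulrDl mul1r addrC lerD// (le_trans Py)//.
    by rewrite ler_wpM2l//; have := r_le_h J; have := r_gt0 J; lra.
  move: xy; rewrite lt_min => /andP[xy1 xy2].
  have Oy : Omega y by apply: Orho; rewrite mx_norm_ball.
  by split=> //; exact: urho.
have avg_near : `|avg (r J) (P (h J)) - u x| <= e.
  have rJn : 0 < r J ^+ n by rewrite exprn_gt0.
  rewrite -lee_fin -(@lee_pmul2r _ (r J ^+ n)%:E) ?lte_fin//.
  apply: le_trans (cell_average_dist oO cu _ (r_gt0 J) _) _.
    by move=> y /close[].
  have -> : (e%:E * (r J ^+ n)%:E =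
      \int[mu]_(y in cell (r J) (cell_index (r J) (P (h J)))) (cst e%:E) y)%E.
    rewrite integral_cst; last exact: measurable_cell.
    by congr (_ * _)%E; exact/esym/lebesgue_cell.
  have mcell : measurable (cell (r J) (cell_index (r J) (P (h J)))).
    exact: measurable_cell.
  have cell_close y : cell (r J) (cell_index (r J) (P (h J))) y ->
      Omega y /\ `|u x - u y| < e.
    by move=> Qy; apply: close => i; rewrite ltW// cell_coord_lt.
  apply: ge0_le_integral => //.
    apply/measurable_EFinP; apply: (measurableT_comp (@normr_measurable R setT)).
    apply: measurable_funB => //.
    apply: measurable_funS (measurable_fun_within_continuous oO cu).
      exact: open_measurable_rV.
    by move=> y /cell_close[].
  by move=> y /cell_close[_ /ltW]; rewrite lee_fin distrC.
rewrite distrC -(subrKA (avg (r J) (P (h J)))).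
apply: le_trans (ler_normD _ _) _; apply: lerD => //.
exact: le_trans (telescope _ (leqnn J)) (sumK J).
Qed.

End pointwise.

(** * Integration and summation over the scales *)

Section summation.
Context {R : realType} {n : nat}.
Local Notation rV := 'rV[R]_n.
Local Notation mu := (@lebesgue_rV R n).

Lemma measurable_cube_relation (rho : R) :
  measurable [set xy : rV * rV | cube xy.1 rho xy.2].
Proof.
have mB : measurable_fun setT (fun xy : rV * rV => xy.1 - xy.2).
  apply/measurable_fun_coordP => i; under eq_fun do rewrite !mxE.
  apply: measurable_funB.
    exact: (measurableT_comp (measurable_coord i) measurable_fst).
  exact: (measurableT_comp (measurable_coord i) measurable_snd).
have -> : [set xy : rV * rV | cube xy.1 rho xy.2] =
    (fun xy : rV * rV => xy.1 - xy.2) @^-1` cube 0 rho.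
  have E (v : rV) i : `|(0 - v) ord0 i| = `|v ord0 i| by rewrite sub0r mxE normrN.
  by apply/seteqP; split=> xy H i; have := H i; rewrite E.
by rewrite -[X in measurable X]setTI; apply: mB => //; exact: measurable_cube.
Qed.

Section cube_power.
Variables (f : rV -> \bar R) (E rho : R).
Hypotheses (mf : measurable_fun setT f) (f0 : forall x, (0 <= f x)%E).
Hypotheses (fE : (\int[mu]_x f x = E%:E)%E) (rho0 : 0 < rho).

Let H : rV * rV -> \bar R :=
  (fun xy => f xy.2) \_ [set xy : rV * rV | cube xy.1 rho xy.2].

Let mH : measurable_fun setT H.
Proof.
apply/measurable_restrict => //; first exact: measurable_cube_relation.
by rewrite setTI; apply: measurable_funTS; exact: measurableT_comp mf measurable_snd.
Qed.

Let H0 xy : (0 <= H xy)%E.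
Proof. by apply: erestrict_ge0 => ? _; exact: f0. Qed.

Let HE x : (\int[mu]_y H (x, y) = \int[mu]_(y in cube x rho) f y)%E.
Proof.
rewrite [RHS]integral_mkcond; apply: eq_integral => y _; rewrite /H !patchE.
have -> // : ((x, y) \in [set xy : rV * rV | cube xy.1 rho xy.2]) = (y \in cube x rho).
by apply/idP/idP => /set_mem xy; exact/mem_set.
Qed.

Let cube_energy x := fine (\int[mu]_(y in cube x rho) f y)%E.

Let cube_energy_le x : (\int[mu]_(y in cube x rho) f y <= E%:E)%E.
Proof. by rewrite -fE; apply: ge0_subset_integral => //; exact: measurable_cube. Qed.

Let cube_energyE x : (\int[mu]_(y in cube x rho) f y = (cube_energy x)%:E)%E.
Proof.
rewrite /cube_energy fineK// ge0_fin_numE ?integral_ge0//.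
by apply: le_lt_trans (cube_energy_le x) _; rewrite ltry.
Qed.

Lemma measurable_cube_energy :
  measurable_fun setT (cube_energy : rV -> measurableTypeR R).
Proof.
apply/measurable_EFinP; have := @measurable_fun_fubini_tonelli_F _ _ _ _ R mu H mH H0.
by apply: eq_measurable_fun => x _; rewrite /fubini_F HE cube_energyE.
Qed.

(** By Tonelli and the symmetry [cubeC], each y is counted over the x in the cube around y, of
    measure (2 rho)^n. *)
Lemma integral_cube_energy :
  (\int[mu]_x (cube_energy x)%:E = ((2 * rho) ^+ n * E)%:E)%E.
Proof.
under eq_integral do rewrite -cube_energyE -HE.
rewrite (@fubini_tonelli _ _ _ _ R mu mu H mH H0) EFinM -fE -ge0_integralZl//; last first.
  by rewrite lee_fin exprn_ge0// mulr_ge0// ltW.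
apply: eq_integral => y _.
rewrite -(lebesgue_measure_cube y rho0) muleC -integral_cst; last exact: measurable_cube.
rewrite [RHS]integral_mkcond; apply: eq_integral => x _; rewrite /H !patchE.
have -> // : ((x, y) \in [set xy : rV * rV | cube xy.1 rho xy.2]) = (x \in cube y rho).
by apply/idP/idP => /set_mem xy; apply/mem_set; apply/cubeC.
Qed.

(** One factor of the power is integrated and the others are bounded by the total: g^k <= E^(k-1) g.
    The exponent will be k = q / p, at least 1 because p <= q. *)
Lemma integral_cube_energy_powR (k : R) : 1 <= k ->
  (\int[mu]_x (cube_energy x `^ k)%:E <= ((2 * rho) ^+ n * E `^ k)%:E)%E.
Proof.
move=> k1; have ce0 x : 0 <= cube_energy x by rewrite fine_ge0// integral_ge0.
have ceE x : cube_energy x <= E by rewrite -lee_fin -cube_energyE.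
have E0 : 0 <= E by rewrite -lee_fin -fE integral_ge0.
have powB (y : R) : 0 <= y -> y `^ k = y `^ (k - 1) * y.
  rewrite le_eqVlt => /predU1P[<-|y0].
    by rewrite powR0 ?mulr0// gt_eqF// (lt_le_trans ltr01).
  by rewrite -{3}(powRr1 (ltW y0)) -powRD ?subrK// (gt_eqF y0) implybT.
apply: (@le_trans _ _ (\int[mu]_x ((E `^ (k - 1))%:E * (cube_energy x)%:E))%E).
  apply: ge0_le_integral => //.
  - by move=> x _; rewrite lee_fin powR_ge0.
  - apply/measurable_EFinP.
    exact: (measurableT_comp (measurable_powR k) measurable_cube_energy).
  - apply: emeasurable_funM => //.
    by apply/measurable_EFinP; exact: measurable_cube_energy.
  - move=> x _; rewrite lee_fin powB// ler_wpM2r// ge0_ler_powR ?nnegrE//.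
    by rewrite subr_ge0.
rewrite ge0_integralZl//; first last.
- by rewrite lee_fin powR_ge0.
- by move=> x _; rewrite lee_fin.
- by apply/measurable_EFinP; exact: measurable_cube_energy.
by rewrite integral_cube_energy -EFinM (powB E)// mulrCA.
Qed.

End cube_power.

End summation.

Section energy_bound.
Context {R : realType} {n : nat}.
Local Notation rV := 'rV[R]_n.
Local Notation mu := (@lebesgue_rV R n).

Lemma geometric_sum_le (z : R) J : 0 <= z < 1 ->
  \sum_(0 <= j < J) z ^+ j <= (1 - z)^-1.
Proof.
move=> /andP[z0 z1]; rewrite -[leRHS]mul1r ler_pdivlMr ?subr_gt0//.
suff -> : (\sum_(0 <= j < J) z ^+ j) * (1 - z) = 1 - z ^+ J.
  by rewrite gerBl exprn_ge0.
elim: J => [|J IH]; first by rewrite big_geq// mul0r subrr.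
by rewrite big_nat_recr//= mulrDl IH exprS; ring.
Qed.

Lemma nneseries_le (f : nat -> \bar R) (B : \bar R) : (forall j, (0 <= f j)%E) ->
  (forall J, (\sum_(0 <= j < J) f j <= B)%E) -> (\sum_(0 <= j <oo) f j <= B)%E.
Proof.
move=> f0 fB; apply: lime_le; first by apply: is_cvg_nneseries.
by apply: nearW.
Qed.

(** Each (nu rat)^j g_j is at most the l^q norm of that sequence; dividing by nu^j leaves a
    geometric series of ratio 1/nu. The strict bound on q leaves room for the weight nu > 1. *)
Lemma weighted_sum_le (K rat nu q sigma : R) (g : nat -> R) J :
  0 <= K -> 0 < rat -> 1 < nu -> 0 < q -> (forall j, 0 <= g j) ->
  (\sum_(0 <= j <oo) (((nu * rat) `^ q) ^+ j * g j `^ q)%:E <= sigma%:E)%E ->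
  \sum_(0 <= j < J) K * rat ^+ j * g j <= K / (1 - nu^-1) * sigma `^ q^-1.
Proof.
move=> K0 rat0 nu1 q0 g0 Ssigma.
have nu0 : 0 < nu by apply: lt_trans nu1.
have nr0 : 0 < nu * rat by rewrite mulr_gt0.
have term j : (nu * rat) ^+ j * g j <= sigma `^ q^-1.
  have nrj : 0 <= (nu * rat) ^+ j * g j by rewrite mulr_ge0// exprn_ge0// ltW.
  have : ((nu * rat) ^+ j * g j) `^ q <= sigma.
    rewrite -lee_fin; apply: le_trans Ssigma.
    apply: le_trans (nneseries_lim_ge j.+1 _); last first.
      by move=> i _ _; rewrite lee_fin mulr_ge0 ?exprn_ge0 ?powR_ge0.
    rewrite big_nat_recr//= powRM ?exprn_ge0 ?(ltW nr0)// powR_exprn ?(ltW nr0)//.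
    by rewrite leeDr// sume_ge0// => i _; rewrite lee_fin mulr_ge0 ?exprn_ge0 ?powR_ge0.
  have iq0 : 0 <= q^-1 by rewrite invr_ge0 ltW.
  have sq0 := powR_ge0 ((nu * rat) ^+ j * g j) q.
  move=> /[dup] /(le_trans sq0) sigma0 /(ge0_ler_powR iq0).
  rewrite !nnegrE => /(_ sq0 sigma0).
  by rewrite -powRrM mulfV ?gt_eqF// powRr1.
have sq0 : 0 <= sigma `^ q^-1 by exact: powR_ge0.
apply: (@le_trans _ _ (\sum_(0 <= j < J) K * sigma `^ q^-1 * nu^-1 ^+ j)).
  apply: ler_sum => j _; rewrite -!mulrA ler_wpM2l//.
  rewrite exprVn ler_pdivlMr ?exprn_gt0//; apply: le_trans (term j).
  by rewrite exprMn le_eqVlt; apply/orP; left; apply/eqP; ring.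
rewrite -mulr_sumr [leRHS]mulrAC ler_wpM2l ?mulr_ge0//.
by rewrite geometric_sum_le// invr_ge0 ltW//= invf_lt1.
Qed.

Variables (delta tau p q s C L a nu E : R) (Omega : set rV) (x0 : rV) (u : rV -> R).
Local Notation d := (fun z => dist_set z (boundary Omega)).
Local Notation dens := (energy_density delta tau p Omega u).
Let b : R := (L / 4) `^ s / C.
Let rat : R := level_ratio (n := n) delta p s.
Let K : R := level_const (n := n) delta p s L a.

Lemma level_ratio_gt0 : 0 < rat.
Proof. by rewrite mulr_gt0// powR_gt0// ?divr_gt0 ?powR_gt0// invr_gt0. Qed.

(** The first factor is the constant of [weighted_sum_le] to the power q. The second is the sum over
    j of (nu rat)^(qj) times the measure (8 L 2^(-j))^n of the cubes of half-side 4 h_j. *)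
Definition energy_const : R :=
  (K / (1 - nu^-1)) `^ q * ((8 * L) ^+ n / (1 - (nu * rat) `^ q * 2^-1 ^+ n)).

Hypotheses (oO : open Omega) (cu : {within Omega, continuous u}).
Hypotheses (n0 : (0 < n)%N) (delta0 : 0 <= delta) (p1 : 1 <= p) (s1 : 1 <= s).
Hypotheses (C0 : 0 < C) (L0 : 0 < L) (Ls : L `^ s = C * d x0).
Hypotheses (tau0 : 0 < tau) (a0 : 0 < a) (aL : 4 * a <= L).
Hypotheses (ab : 8 * n%:R * a <= b) (atb : 8 * n%:R * a <= tau * b).
Hypothesis john : forall x, Omega x -> exists g, john_curve s C Omega x0 x g.
Hypotheses (pq : p <= q) (nu1 : 1 < nu).
Hypothesis ratio_lt1 : (nu * rat) `^ q * 2^-1 ^+ n < 1.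
Hypothesis energyE : (\int[mu]_y dens y = E%:E)%E.

Lemma level_const_gt0 : 0 < K.
Proof.
have t0 : 0 < (2^-1 : R) `^ s by rewrite powR_gt0// invr_gt0.
have n0' : 0 < n%:R :> R by rewrite ltr0n.
by rewrite /K /level_const !mulr_gt0// powR_gt0// ?addr_gt0 ?divr_gt0 ?mulr_gt0//
  ?powR_gt0 ?mulr_gt0 ?invr_gt0 ?exprn_gt0.
Qed.

Lemma energy_bound :
  (\int[mu]_(x in Omega) (`|u x - average (cell a (cell_index a x0)) u| `^ q)%:E <=
    (energy_const * E `^ (q / p))%:E)%E.
Proof.
have p0 : 0 < p by exact: lt_le_trans p1.
have q0 : 0 < q by exact: lt_le_trans pq.
have rat0 := level_ratio_gt0.
have K0 := level_const_gt0.
set c := average _ u.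
pose G j x := level_energy delta tau p L Omega u j x.
pose w := (nu * rat) `^ q.
have w0 : 0 <= w by exact: powR_ge0.
have half0 : 0 < 2^-1 :> R by rewrite invr_gt0.
have mO := open_measurable_rV oO.
have dens0 := energy_density_ge0 delta tau p Omega u.
have mdens := measurable_energy_density delta tau p oO cu.
have rho0 j : 0 < 4 * (L * 2^-1 ^+ j) by rewrite !mulr_gt0// exprn_gt0.
pose T j x : \bar R := (w ^+ j * G j x `^ (q / p))%:E.
have T0 j x : (0 <= T j x)%E by rewrite lee_fin mulr_ge0 ?exprn_ge0 ?powR_ge0.
have mT j : measurable_fun setT (T j).
  apply/measurable_EFinP; apply: measurable_funM => //.
  apply: (measurableT_comp (measurable_powR _)).
  exact: (measurable_cube_energy _ mdens dens0 energyE).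
pose M := K / (1 - nu^-1).
have nuV : 0 < 1 - nu^-1 by rewrite subr_gt0 invf_lt1// (lt_trans _ nu1).
have M0 : 0 < M by rewrite divr_gt0.
have pointwise x : Omega x ->
    ((`|u x - c| `^ q)%:E <= (M `^ q)%:E * \sum_(0 <= j <oo) T j x)%E.
  move=> Ox; have [g johng] := john Ox.
  have S0 : (0 <= \sum_(0 <= j <oo) T j x)%E by exact: nneseries_ge0.
  (* Where the series is infinite the bound is trivial; elsewhere its value is the [sigma] of
     [weighted_sum_le]. *)
  case SE : (\sum_(0 <= j <oo) T j x)%E S0 => [sigma| |//]; last first.
    by move=> _; rewrite gt0_muley ?leey// lte_fin powR_gt0.
  rewrite lee_fin => sigma0.
  have fin : (\int[mu]_y dens y < +oo)%E by rewrite energyE ltry.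
  have : `|u x - c| <= M * sigma `^ q^-1.
    apply: (pointwise_bound oO cu n0 delta0 p1 s1 C0 L0 Ls tau0 a0 aL ab atb fin
      Ox johng) => J.
    apply: (weighted_sum_le (g := fun j => G j x `^ p^-1) J (ltW K0) rat0 nu1 q0).
      by move=> j; exact: powR_ge0.
    rewrite -SE le_eqVlt; apply/orP; left; apply/eqP.
    by apply: eq_eseriesr => j _; rewrite /T -powRrM [p^-1 * q]mulrC.
  rewrite -EFinM lee_fin => uc.
  have -> : M `^ q * sigma = (M * sigma `^ q^-1) `^ q.
    by rewrite powRM ?powR_ge0 ?(ltW M0)// -powRrM mulVf ?gt_eqF// powRr1.
  by rewrite ge0_ler_powR ?nnegrE ?(ltW q0)// mulr_ge0 ?powR_ge0 ?(ltW M0).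
have mu_ := measurable_fun_within_continuous oO cu.
apply: (@le_trans _ _ (\int[mu]_(x in Omega) ((M `^ q)%:E * \sum_(0 <= j <oo) T j x))%E).
  apply: ge0_le_integral => //.
  - apply/measurable_EFinP; apply: (measurableT_comp (measurable_powR q)).
    apply: (measurableT_comp (@normr_measurable R setT)).
    exact: measurable_funB.
  - apply: emeasurable_funM => //; apply: ge0_emeasurable_sum => // j _.
    exact: measurable_funTS.
rewrite ge0_integralZl//; first last.
- by rewrite lee_fin powR_ge0.
- by move=> x _; exact: nneseries_ge0.
- by apply: ge0_emeasurable_sum => // j _; exact: measurable_funTS.
rewrite /energy_const -/M -mulrA EFinM lee_wpmul2l ?lee_fin ?powR_ge0//.
rewrite integral_nneseries//; last by move=> j; exact: measurable_funTS.
have level j : (\int[mu]_(x in Omega) T j x <=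
    ((w * 2^-1 ^+ n) ^+ j * ((8 * L) ^+ n * E `^ (q / p)))%:E)%E.
  apply: (@le_trans _ _ (\int[mu]_x T j x)%E); first exact: ge0_subset_integral.
  rewrite /T; under eq_integral do rewrite EFinM.
  rewrite ge0_integralZl//; first last.
  - by rewrite lee_fin exprn_ge0.
  - by move=> x _; rewrite lee_fin powR_ge0.
  - apply/measurable_EFinP; apply: (measurableT_comp (measurable_powR _)).
    exact: (measurable_cube_energy _ mdens dens0 energyE).
  have k1 : 1 <= q / p by rewrite ler_pdivlMr// mul1r.
  apply: (@le_trans _ _ ((w ^+ j)%:E *
      ((2 * (4 * (L * 2^-1 ^+ j))) ^+ n * E `^ (q / p))%:E)%E).
    rewrite lee_wpmul2l ?lee_fin ?exprn_ge0//.
    exact: (integral_cube_energy_powR mdens dens0 energyE (rho0 j) k1).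
  rewrite -EFinM lee_fin le_eqVlt; apply/orP; left; apply/eqP.
  have -> : 2 * (4 * (L * 2^-1 ^+ j)) = 8 * L * 2^-1 ^+ j by ring.
  by rewrite (exprMn _ (8 * L)) (exprMn _ w) -!exprM [(j * n)%N]mulnC; ring.
apply: nneseries_le => [j|J]; first exact: integral_ge0.
apply: (@le_trans _ _ (\sum_(0 <= j < J)
    ((w * 2^-1 ^+ n) ^+ j * ((8 * L) ^+ n * E `^ (q / p)))%:E)%E).
  by apply: lee_sum => j _.
rewrite sumEFin lee_fin -mulr_suml [leLHS]mulrC [leRHS]mulrAC ler_wpM2l//.
  by rewrite mulr_ge0 ?powR_ge0// exprn_ge0// mulr_ge0// ltW.
by apply: geometric_sum_le; rewrite ratio_lt1 andbT mulr_ge0// exprn_ge0// ltW.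
Qed.

End energy_bound.

(** * From an arbitrary constant to the mean over the domain *)

Section recentering.
Context {R : realType} {n : nat}.
Local Notation rV := 'rV[R]_n.
Local Notation mu := (@lebesgue_rV R n).

(** The mean differs from c by at most 2 (B / mu Omega)^(1/q), by [average_dist] and
    [optimize_young]; the triangle inequality then replaces c by the mean. *)
Lemma average_recenter (Omega : set rV) (u : rV -> R) (q c B : R) :
  measurable Omega -> (0 < mu Omega < +oo)%E ->
  measurable_fun Omega (u : rV -> measurableTypeR R) -> 1 <= q ->
  (\int[mu]_(x in Omega) (`|u x - c| `^ q)%:E <= B%:E)%E ->
  (\int[mu]_(x in Omega) (`|u x - average Omega u| `^ q)%:E <=
    (2 `^ q * (1 + 2 `^ q) * B)%:E)%E.
Proof.
move=> mO muO mu_ q1 uB.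
have q0 : 0 < q by exact: lt_le_trans q1.
have /andP[mu0 muoo] := muO.
have muE : mu Omega = (fine (mu Omega))%:E by rewrite fineK// ge0_fin_numE.
set v := fine (mu Omega) in muE.
have v0 : 0 < v by rewrite -lte_fin -muE.
have muc : measurable_fun Omega (fun x => `|u x - c| : measurableTypeR R).
  apply: (measurableT_comp (@normr_measurable R setT)).
  exact: measurable_funB.
have mucq : measurable_fun Omega (fun x => (`|u x - c| `^ q)%:E).
  by apply/measurable_EFinP; exact: (measurableT_comp (measurable_powR q)).
have B0 : 0 <= B.
  by rewrite -lee_fin (le_trans _ uB)// integral_ge0// => x _; rewrite lee_fin powR_ge0.
have young lam : 0 < lam ->
    (\int[mu]_(x in Omega) `|u x - c|%:E <= (lam * v + lam `^ (1 - q) * B)%:E)%E.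
  move=> lam0.
  apply: (@le_trans _ _ (\int[mu]_(x in Omega)
      (lam%:E + (lam `^ (1 - q))%:E * (`|u x - c| `^ q)%:E))%E).
    apply: ge0_le_integral => //.
    - exact/measurable_EFinP.
    - by apply: emeasurable_funD => //; exact: emeasurable_funM.
    - by move=> x _; rewrite -EFinM -EFinD lee_fin young_powR.
  rewrite (ge0_integral_affine mO muE) ?powR_ge0 ?(ltW lam0)//.
  rewrite (EFinD (lam * v)) (EFinM (_ `^ _)) leeD2l// lee_wpmul2l// lee_fin.
  exact: powR_ge0.
(* Young's inequality with lam = 1 on a set of finite measure makes u integrable, so [average] is a
   true mean. *)
have iu : mu.-integrable Omega (EFin \o u).
  have ic := integrable_cst_lty c mO muoo.
  have iuc : mu.-integrable Omega (EFin \o (fun x => u x - c)).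
    apply/integrableP; split; first by apply/measurable_EFinP; exact: measurable_funB.
    by apply: le_lt_trans (young 1 ltr01) _; rewrite ltry.
  apply: eq_integrable (integrableD mO iuc ic) => // x _.
  by rewrite /= -EFinD subrK.
pose D := 2 * (B / v) `^ q^-1.
have D0 : 0 <= D by rewrite mulr_ge0// powR_ge0.
have avg_c : `|average Omega u - c| <= D.
  have := @optimize_young _ q 1 (B / v) `|average Omega u - c| q1 ltr01.
  rewrite divr_ge0 ?(ltW v0)// powR1 mul1r => /(_ isT); apply => lam lam0.
  rewrite mul1r -(ler_pM2r v0) mulrDl mulrAC divfK ?gt_eqF// [B * _]mulrC.
  rewrite -lee_fin EFinM -muE; apply: le_trans (average_dist c mO muO iu) _.
  exact: young.
have Dq : D `^ q * v = 2 `^ q * B.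
  rewrite /D powRM ?powR_ge0// -powRrM mulVf ?gt_eqF// powRr1 ?divr_ge0 ?(ltW v0)//.
  by rewrite -mulrA divfK ?gt_eqF.
(* The sum is at most twice the larger term. *)
have sum_powR (x y : R) : 0 <= x -> 0 <= y ->
    (x + y) `^ q <= 2 `^ q * y `^ q + 2 `^ q * x `^ q.
  move=> x0 y0; have [xy|yx] := leP x y.
    apply: (@le_trans _ _ ((2 * y) `^ q)).
      by rewrite ge0_ler_powR ?nnegrE ?(ltW q0) ?addr_ge0 ?mulr_ge0//; lra.
    by rewrite powRM// lerDl mulr_ge0 ?powR_ge0.
  apply: (@le_trans _ _ ((2 * x) `^ q)).
    by rewrite ge0_ler_powR ?nnegrE ?(ltW q0) ?addr_ge0 ?mulr_ge0//; lra.
  by rewrite powRM// lerDr mulr_ge0 ?powR_ge0.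
apply: (@le_trans _ _ (\int[mu]_(x in Omega)
    ((2 `^ q * D `^ q)%:E + (2 `^ q)%:E * (`|u x - c| `^ q)%:E))%E).
  apply: ge0_le_integral => //.
  - apply/measurable_EFinP; apply: (measurableT_comp (measurable_powR q)).
    apply: (measurableT_comp (@normr_measurable R setT)).
    exact: measurable_funB.
  - by apply: emeasurable_funD => //; exact: emeasurable_funM.
  - move=> x _; rewrite -EFinM -EFinD lee_fin.
    apply: le_trans (sum_powR _ _ (normr_ge0 _) D0).
    rewrite ge0_ler_powR ?nnegrE ?(ltW q0) ?addr_ge0//.
    rewrite -(subrKA c); apply: le_trans (ler_normD _ _) _.
    by rewrite lerD2l distrC.
rewrite (ge0_integral_affine mO muE) ?mulr_ge0 ?powR_ge0//.
have -> : 2 `^ q * (1 + 2 `^ q) * B = 2 `^ q * D `^ q * v + 2 `^ q * B.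
  by rewrite -(mulrA _ (D `^ q)) Dq; ring.
by rewrite EFinD (EFinM (2 `^ q) B) leeD2l// lee_wpmul2l// lee_fin powR_ge0.
Qed.

End recentering.

(* [level_ratio] is [2^(kappa / p)], where [kappa] is the denominator in the
   upper bound for [q]. *)
Lemma level_ratio_slack {R : realType} (n : nat) (delta p q s : R) :
  1 <= p -> 0 < q ->
  q * (s * (n%:R - p * delta) + (s - 1) * (p - 1)) < n%:R * p ->
  exists2 nu, 1 < nu &
    (nu * level_ratio (n := n) delta p s) `^ q * 2^-1 ^+ n < 1.
Proof.
move=> p1 q0; set kappa := s * _ + _ => qk.
have p0 : 0 < p by exact: lt_le_trans p1.
have half0 : 0 < 2^-1 :> R by rewrite invr_gt0.
have half1 : 2^-1 < 1 :> R by rewrite invf_lt1// ltr1n.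
have half_neq0 x y : (x == y :> R) ==> (2^-1 != 0 :> R).
  by rewrite (gt_eqF half0) implybT.
(* Half the gap left by the strict bound on q; with nu = 2^eps the product becomes 2^(- eps q). *)
pose eps := (n%:R / q - kappa / p) / 2.
have eps0 : 0 < eps.
  rewrite divr_gt0// subr_gt0 ltr_pdivlMr// mulrAC ltr_pdivrMr//.
  by rewrite mulrC.
have pow_lt1 x : 0 < x -> 2^-1 `^ x < 1 :> R.
  move=> x0; have := gt0_ltr_powR x0 _ _ half1.
  by rewrite !nnegrE powR1; apply => //; exact: ltW.
have ratioE : level_ratio (n := n) delta p s = 2^-1 `^ (- (kappa / p)).
  rewrite /level_ratio -[X in X / _](powRr1 (ltW half0)) -powRB ?half_neq0//.
  rewrite -!powRrM -powRD ?half_neq0//; congr powR; rewrite /kappa; field.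
  by rewrite gt_eqF.
exists (2^-1 `^ (- eps)).
  by rewrite powRN invf_gt1 ?powR_gt0// pow_lt1.
rewrite ratioE -powRD ?half_neq0// -powRrM -powR_mulrn ?(ltW half0)//.
rewrite -powRD ?half_neq0//.
have -> : (- eps + - (kappa / p)) * q + n%:R = eps * q.
  by rewrite /eps; field; rewrite !gt_eqF.
by rewrite pow_lt1// mulr_gt0.
Qed.

(** * Measure and depth of the domain, and conclusion *)

Section domain.
Context {R : realType} {n : nat}.
Local Notation rV := 'rV[R]_n.
Local Notation mu := (@lebesgue_rV R n).
Local Notation d Omega := (fun z : rV => dist_set z (boundary Omega)).

Lemma open_measure_gt0 (Omega : set rV) x : open Omega -> Omega x ->
  (0 < mu Omega)%E.
Proof.
move=> oO Ox.
have /nbhs_ballP[e /= e0 eO] : nbhs x Omega by exact: open_nbhs_nbhs.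
apply: (@lt_le_trans _ _ (mu (cube x e))).
  by rewrite lebesgue_measure_cube// lte_fin exprn_gt0// mulr_gt0.
apply: le_measure; rewrite ?inE; [exact: measurable_cube|exact: open_measurable_rV|].
by move=> y xy; apply: eO; rewrite mx_norm_ball; exact: norm_lt_coord.
Qed.

Lemma bounded_measure_lty (Omega : set rV) : open Omega -> bounded_set Omega ->
  (mu Omega < +oo)%E.
Proof.
move=> oO [M [Mr MO]]; have M1 : 0 < `|M| + 2 by rewrite ltr_wpDl.
apply: (@le_lt_trans _ _ (mu (cube 0 (`|M| + 2)))); last first.
  by rewrite lebesgue_measure_cube// ltry.
apply: le_measure; rewrite ?inE; [exact: open_measurable_rV|exact: measurable_cube|].
move=> y Oy i; apply: le_lt_trans (coord_le_norm _ _) _; rewrite sub0r normrN.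
apply: (@le_lt_trans _ _ (`|M| + 1)); last by rewrite ltrD2l ltr1n.
by apply: MO => //; rewrite ltr_pwDr// ler_norm.
Qed.

(** If the distance were 0, the John condition at t = 1 would force every John curve to have length
    0, yet the open set Omega contains a point other than x0. This also excludes the default value 0
    of [dist_set] on an empty boundary. *)
Lemma john_center_dist_gt0 (s C : R) (Omega : set rV) x0 : (0 < n)%N -> 0 < s ->
  open Omega -> Omega x0 ->
  (forall x, Omega x -> exists g, john_curve s C Omega x0 x g) -> 0 < d Omega x0.
Proof.
move=> n0 s0 oO Ox0 john; rewrite lt_neqAle dist_set_ge0 andbT eq_sym.
apply/negP => /eqP d0.
have /nbhs_ballP[e /= e0 eO] : nbhs x0 Omega by exact: open_nbhs_nbhs.
pose x : rV := x0 + const_mx (e / 2).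
have Ox : Omega x.
  apply: eO; rewrite mx_norm_ball/= /x opprD addrA subrr sub0r normrN.
  apply: norm_lt_coord => // i; rewrite mxE ger0_norm ?divr_ge0 ?ltW//.
  by rewrite ltr_pdivrMr// ltr_pMr// ltr1n.
have [g [_ _ g0 g1 /(_ 1)]] := john _ Ox.
rewrite ltr01 lexx g1 d0 mulr0 => /(_ isT).
have := discrete_length_le g (m := 1) (i := 1) isT.
rewrite big_nat1 mul0r divr1 g0 g1 => len.
have x_x0 : 0 < enorm (x - x0).
  rewrite enorm_gt0// /x addrAC subrr add0r; apply/negP => /eqP/rowP/(_ (Ordinal n0)).
  by rewrite !mxE; apply/eqP; rewrite gt_eqF// divr_gt0.
rewrite leNgt => /negP; apply; apply: poweR_gt0.
by apply: lt_le_trans len; rewrite lte_fin.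
Qed.

Lemma john_curve_le (s C C' : R) (Omega : set rV) x0 x g : C <= C' ->
  john_curve s C Omega x0 x g -> john_curve s C' Omega x0 x g.
Proof.
move=> CC' [? ? ? ? gd]; split => // t /gd; move/le_trans; apply.
by rewrite lee_fin ler_wpM2r// dist_set_ge0.
Qed.

End domain.

Unset Implicit Arguments.

Theorem theorem0p2 (R : realType) (n : nat) (delta tau s p q : R)
    (Omega : set 'rV[R]_n) (hn : (2 <= n)%N)
    (hdelta : 0 < delta < 1) (htau : 0 < tau) (hs : 1 <= s)
    (hOmega : john_domain s Omega)
    (hp : p < n%:R / delta)
    (hsn : s < n%:R / (n%:R - p * delta))
    (hp1 : 1 <= p) (hpq : p <= q)
    (hq : q < n%:R * p / (s * (n%:R - p * delta) + (s - 1) * (p - 1))) :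
  fractional_sobolev_poincare delta tau q p Omega.
Proof.
have [[oO _ bO] [C0 [x0 [Ox0 john0]]]] := hOmega.
have /andP[delta0 _] := hdelta.
have n0 : (0 < n)%N by exact: leq_trans hn.
have nR0 : 0 < n%:R :> R by rewrite ltr0n.
have s0 : 0 < s by exact: lt_le_trans hs.
have p0 : 0 < p by exact: lt_le_trans hp1.
have q0 : 0 < q by exact: lt_le_trans hpq.
have pd : 0 < n%:R - p * delta by rewrite subr_gt0 -ltr_pdivlMr.
have [nu nu1 ratio] : exists2 nu, 1 < nu &
    (nu * level_ratio (n := n) delta p s) `^ q * 2^-1 ^+ n < 1.
  apply: level_ratio_slack => //; rewrite -ltr_pdivlMr//.
  by rewrite ltr_pwDl ?mulr_gt0// mulr_ge0// subr_ge0.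
have d0 := john_center_dist_gt0 n0 s0 oO Ox0 john0.
(* Enlarging the constant preserves the John condition and makes its sign explicit. *)
pose C := Num.max C0 1.
have C_gt0 : 0 < C by rewrite lt_max ltr01 orbT.
have john x : Omega x -> exists g, john_curve s C Omega x0 x g.
  move=> /john0[g johng]; exists g; apply: john_curve_le johng.
  by rewrite le_max lexx.
pose L := (C * dist_set x0 (boundary Omega)) `^ s^-1.
have Cd0 : 0 < C * dist_set x0 (boundary Omega) by rewrite mulr_gt0.
have L0 : 0 < L by rewrite powR_gt0.
have Ls : L `^ s = C * dist_set x0 (boundary Omega).
  by rewrite -powRrM mulVf ?gt_eqF// powRr1// ltW.
pose b := (L / 4) `^ s / C.
have b0 : 0 < b by rewrite divr_gt0// powR_gt0// divr_gt0.
have n80 : 0 < 8 * n%:R :> R by rewrite mulr_gt0.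
(* The three bounds give r j <= h j / 4 and cells small compared with both the distance to the
   boundary and its multiple by tau. *)
pose a := Num.min (L / 4) (Num.min (b / (8 * n%:R)) (tau * b / (8 * n%:R))).
have a0 : 0 < a by rewrite !lt_min (divr_gt0 b0 n80) (divr_gt0 (mulr_gt0 htau b0) n80) divr_gt0.
have aL : 4 * a <= L by rewrite mulrC -ler_pdivlMr// ge_min lexx.
have ab : 8 * n%:R * a <= b by rewrite mulrC -ler_pdivlMr// !ge_min lexx orbT.
have atb : 8 * n%:R * a <= tau * b.
  by rewrite mulrC -ler_pdivlMr// !ge_min lexx !orbT.
pose K := energy_const (n := n) delta p q s L a nu.
have K0 : 0 < K.
  apply: mulr_gt0.
    rewrite powR_gt0// divr_gt0 ?level_const_gt0//.
    by rewrite subr_gt0 invf_lt1// (lt_trans _ nu1).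
  by rewrite divr_gt0 ?subr_gt0 ?exprn_gt0 ?(mulr_gt0 _ L0).
have muO : (0 < lebesgue_rV n Omega < +oo)%E.
  by rewrite (open_measure_gt0 oO Ox0) bounded_measure_lty.
have c0 : 0 < 2 `^ q * (1 + 2 `^ q) * K.
  by rewrite mulr_gt0// mulr_gt0 ?addr_gt0 ?powR_gt0.
exists (2 `^ q * (1 + 2 `^ q) * K) => //.
move=> u cu; rewrite fractional_energyE.
have E0 : (0 <= \int[lebesgue_rV n]_x energy_density delta tau p Omega u x)%E.
  by apply: integral_ge0 => x _; exact: energy_density_ge0.
(* For infinite energy the right side is infinite, its constant being positive. *)
case energyE : (\int[lebesgue_rV n]_x _)%E E0 => [E| |//] _; last first.
  by rewrite poweRyr ?gt_eqF ?divr_gt0// gt0_muley ?leey.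
rewrite poweR_EFin -EFinM -(mulrA _ K).
apply: (average_recenter (c := average (cell a (cell_index a x0)) u)) => //.
- exact: open_measurable_rV.
- exact: measurable_fun_within_continuous.
- exact: le_trans hpq.
exact: (energy_bound oO cu n0 (ltW delta0) hp1 hs C_gt0 L0 Ls htau a0 aL ab atb
  john hpq nu1 ratio energyE).
Qed.
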